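(* Let $G$ be a simple undirected graph on $\{1,\dots,n\}$ with edge weights $w_{ij}$ in a commutative ring $\mathcal A$. Let $H_0\subset G$ be a negative graph (possibly empty), let $k_2,k_3,\dots,k_n\ge 0$ be integers, and let $H=H_0\cup 2^{k_2}3^{k_3}\cdots n^{k_n}$, with $e(H)=e(H_0)+\sum_{s=2}^n s\,k_s$. Then $$\rho_G(H)=(-1)^{e(H)}\,d(H_0)\sum_{l_2=k_2}^n\cdots\sum_{l_n=k_n}^n\binom{l_2}{k_2}\cdots\binom{l_n}{k_n}\,2^{\,l_3+\dots+l_n}\,Z\bigl(U(H_0\cup 2^{l_2}3^{l_3}\cdots n^{l_n})\bigr),$$ where $d(H_0)$ is the number of orientations of $H_0$ without sources and sinks, i.e. such that every vertex of $H_0$ has at least one incoming and at least one outgoing edge (with $d(\emptyset)=1$).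
   Context: Graphs: $G\subset\{\{i,j\}: i\neq j\in\{1,\dots,n\}\}$ is a simple undirected graph with vertex set $\{1,\dots,n\}$; the edge $\{i,j\}$ has weight $w_{ij}=w_{ji}$ in the commutative ring $\mathcal A$, and $w_{ij}=0$ if $\{i,j\}\notin G$. The Laplacian matrix $L_G$ is the $n\times n$ matrix with $(L_G)_{ij}=-w_{ij}$ for $i\ne j$ and $(L_G)_{ii}=\sum_{k\neq i}w_{ik}$. For any graph, $v$ denotes the number of vertices, $e$ the number of edges (with multiplicity), and $\chi=v-e$. The $2$-core $\mathrm{core}_2(F)$ of a loopless graph $F$ (multiple edges allowed) is the maximal subgraph in which every vertex is an endpoint of at least two edges (counted with multiplicity). A graph is negative if it has no loops and no multiple edges, equals its own $2$-core, and each of its connected components $G_i$ satisfies $\chi(G_i)<0$. Notation $H_0\cup 2^{k_2}3^{k_3}\cdots n^{k_n}$: here $H_0$ is a fixed negative subgraph of $G$ (with a specified set of vertices and edges); a graph is said to be of the form $H_0\cup 2^{k_2}\cdots n^{k_n}$ if it is the disjoint union of $H_0$ and, for each $s=2,\dots,n$, exactly $k_s$ cycles of length $s$ on arbitrary vertices, each cycle forming a separate connected component; a cycle of length $2$ means a double edge joining two vertices. Only the numbers of cycles of each length, not their positions, are specified. Adding $1^{k_1}$ means adding $k_1$ loops, each loop forming a separate connected component. For a directed graph $Q\subset\{1,\dots,n\}^2$, $[Q]$ is the corresponding undirected graph (a pair of antiparallel edges $(i,j),(j,i)$ becomes a double edge, an edge $(i,i)$ becomes a loop), and $\langle L_G,Q\rangle=\prod_{(i,j)\in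 Q}(L_G)_{ij}$. A directed graph $Q$ is regular if (1) every vertex has at least one incoming and at least one outgoing edge, and (2) any loop $(i,i)$, and any pair of antiparallel edges $(i,j),(j,i)$, forms a separate connected component of $Q$. For $H=H_0\cup 2^{k_2}\cdots n^{k_n}$ put $v(H)=v(H_0)+\sum_{s\ge2} s\,k_s$ and $$\rho_G(H)=\sum_{\Lambda}\langle L_G,\Lambda\rangle,$$ the sum being over all regular directed graphs $\Lambda$ with vertex set $\{1,\dots,n\}$ such that $[\Lambda]$ is of the form $H_0\cup 1^{n-v(H)}2^{k_2}\cdots n^{k_n}$ (an empty sum, equal to $0$, if $v(H)>n$). $U(H_0\cup 2^{l_2}\cdots n^{l_n})$ is the set of all loopless multigraphs $F$ with vertex set $\{1,\dots,n\}$ such that neglecting edge multiplicities $F$ becomes a subgraph of $G$, $\mathrm{core}_2(F)$ is of the form $H_0\cup 2^{l_2}\cdots n^{l_n}$, and $F$ is the union of its $2$-core and forests attached to the vertices of the $2$-core (equivalently, every connected component of $F$ contains a cycle, a double edge counting as a cycle of length $2$). The weight of $F$ is $w(F)=\prod w_{ij}^{m_{ij}}$, where $m_{ij}$ is the multiplicity of the edge $\{i,j\}$ in $F$, and $Z(U)=\sum_{F\in U}w(F)$. *)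

(* Defs.v *)
From mathcomp Require Export all_boot all_order all_algebra.
From mathcomp Require Export boolp classical_sets functions cardinality fsbigop.

Set Implicit Arguments.
Unset Strict Implicit.
Unset Printing Implicit Defensive.

Import GRing.Theory.
Local Open Scope ring_scope.

(** * Undirected multigraphs with vertices in {0, .., n-1}

  A graph is a pair (vertex set, edge multiplicities).  The edge joining i and
  j is the set [set i; j], so that the loop at i is the singleton [set i]. *)

Definition mgraph (n : nat) : Type :=
  ({set 'I_n} * {ffun {set 'I_n} -> nat})%type.

Section Graphs.
Context {n : nat}.
Implicit Types (F K C Phi : mgraph n) (G : {set {set 'I_n}}).
Implicit Types (Q : {set 'I_n * 'I_n}) (c : seq 'I_n) (cs : seq (seq 'I_n)).

Definition vert K : {set 'I_n} := K.1.
Definition mult K (e : {set 'I_n}) : nat := K.2 e.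

Definition is_mgraph K : Prop :=
  forall e, (0 < mult K e)%N -> e \subset vert K /\ (0 < #|e| <= 2)%N.

Definition loopless K : Prop := forall x, mult K [set x]%SET = 0%N.

Definition subgraph C F : Prop :=
  [/\ is_mgraph C, vert C \subset vert F & forall e, (mult C e <= mult F e)%N].

Definition nedges K : nat := \sum_(e : {set 'I_n}) mult K e.

Definition euler_char K : int := #|vert K|%:Z - (nedges K)%:Z.

Definition adj K : rel 'I_n := fun x y => (0 < mult K [set x; y]%SET)%N.

Definition component K (x : 'I_n) : mgraph n :=
  let V := [set y in vert K | connect (adj K) x y]%SET in
  (V, [ffun e : {set 'I_n} => if e \subset V then mult K e else 0%N]).

(** For loopless graphs only: a loop would contribute 1 to the sum. *)
Definition min_degree2 C : Prop :=
  forall x, x \in vert C -> (2 <= \sum_(e : {set 'I_n} | x \in e) mult C e)%N.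

(** [C] is the 2-core of the loopless graph [F]. *)
Definition is_core2 C F : Prop :=
  [/\ subgraph C F, min_degree2 C
    & forall C', subgraph C' F -> min_degree2 C' -> subgraph C' C].

Definition negative K : Prop :=
  [/\ is_mgraph K, loopless K, forall e, (mult K e <= 1)%N, is_core2 K K
    & forall x, x \in vert K -> (euler_char (component K x) < 0)%R].

(** ** Simple host graph, given by its set of edges *)

Definition simple_graph G : Prop := forall e, e \in G -> #|e| = 2%N.

(** Neglecting edge multiplicities, [K] is a subgraph of [G]. *)
Definition support_in K G : Prop := forall e, (0 < mult K e)%N -> e \in G.

(** ** Cycles and the notation H0 \cup 1^k1 2^(k_2) .. n^(k_n)

  The nonempty duplicate-free sequence x_1, .., x_s stands for the cycle with
  edges {x_1,x_2}, .., {x_(s-1),x_s}, {x_s,x_1}: a loop if s = 1, a double edge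
  if s = 2. *)

Definition is_cycle c : bool := uniq c && (0 < size c)%N.

Definition cycle_graph c : mgraph n :=
  ([set x in c]%SET,
   [ffun e => count_mem e [seq [set x; next c x]%SET | x <- c]]).

Definition has_form (H0 : mgraph n) (k1 : nat) (k : 'I_(n.-1) -> nat) K : Prop :=
  exists cs : seq (seq 'I_n),
  [/\ [/\ all is_cycle cs, uniq (flatten cs)
        & [disjoint vert H0 & [set x in flatten cs]%SET]],
      vert K = (vert H0 :|: [set x in flatten cs])%SET,
      forall e, mult K e =
        (mult H0 e + \sum_(c <- cs) mult (cycle_graph c) e)%N,
      count (fun c => size c == 1%N) cs = k1
    & (* the ordinal s : 'I_(n.-1) stands for the cycle length s + 2,
         which thus ranges over 2, .., n *)
      forall s : 'I_(n.-1), count (fun c => size c == s.+2) cs = k s].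

Definition nvert_form (H0 : mgraph n) (k : 'I_(n.-1) -> nat) : nat :=
  (#|vert H0| + \sum_(s < n.-1) s.+2 * k s)%N.

Definition nedges_form (H0 : mgraph n) (k : 'I_(n.-1) -> nat) : nat :=
  (nedges H0 + \sum_(s < n.-1) s.+2 * k s)%N.

(** ** Directed graphs, given by their set of arcs *)

Definition und (V : {set 'I_n}) Q : mgraph n :=
  (V, [ffun e => #|[set p in Q | [set p.1; p.2] == e]%SET|]).

Definition no_source_sink (V : {set 'I_n}) Q : bool :=
  [forall x in V, [exists y, (y, x) \in Q] && [exists y, (x, y) \in Q]].

(** Arcs of the connected component of [x] (in the undirected sense). *)
Definition arcs_of_component Q (x : 'I_n) : {set 'I_n * 'I_n} :=
  [set p in Q | connect (adj (und [set: 'I_n]%SET Q)) x p.1]%SET.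

Definition regular Q : Prop :=
  [/\ no_source_sink [set: 'I_n]%SET Q,
      forall i, (i, i) \in Q -> arcs_of_component Q i = [set (i, i)]%SET
    & forall i j, i != j -> (i, j) \in Q -> (j, i) \in Q ->
        arcs_of_component Q i = [set (i, j); (j, i)]%SET].

(** Number of orientations of the simple graph [H0] without sources and
    sinks. *)
Definition orient_count (H0 : mgraph n) : nat :=
  #|[set Q : {set 'I_n * 'I_n}
      | (und (vert H0) Q == H0) && no_source_sink (vert H0) Q]%SET|.

(** ** Loopless multigraphs with a prescribed 2-core *)

Definition acyclic Phi : Prop :=
  forall c, is_cycle c -> ~ subgraph (cycle_graph c) Phi.

(** [F] is the union of [C] and of trees, each meeting [C] in exactly one
    vertex (a vertex of [C] that carries no tree is a one-vertex tree). *)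
Definition core_with_forests C F : Prop :=
  exists Phi : mgraph n,
  [/\ is_mgraph Phi, acyclic Phi, vert Phi = vert F,
      forall e, mult F e = (mult C e + mult Phi e)%N
    & forall x, x \in vert F ->
        exists! y, y \in vert C /\ connect (adj Phi) x y].

Definition Uset G (H0 : mgraph n) (l : 'I_(n.-1) -> nat) : set (mgraph n) := fun F =>
  [/\ is_mgraph F, vert F = [set: 'I_n]%SET, loopless F, support_in F G
    & exists C, [/\ is_core2 C F, has_form H0 0 l C & core_with_forests C F]].

Section Weights.
Context {A : comPzRingType}.
Variable w : 'I_n -> 'I_n -> A.

Definition laplacian : 'M[A]_n :=
  \matrix_(i, j) if i == j then \sum_(m | m != i) w i m else - w i j.

Definition bracket (L : 'M[A]_n) Q : A := \prod_(p in Q) L p.1 p.2.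

(** If nvert_form H0 k > n the truncated subtraction is 0, but no graph on n
    vertices has the required form, so that the sum is empty. *)
Definition rho (H0 : mgraph n) (k : 'I_(n.-1) -> nat) : A :=
  \sum_(Q : {set 'I_n * 'I_n} |
     `[< regular Q /\
         has_form H0 (n - nvert_form H0 k)%N k (und [set: 'I_n]%SET Q) >])
    bracket laplacian Q.

Definition weight F : A :=
  \prod_(i < n) \prod_(j < n | (i < j)%N) w i j ^+ mult F [set i; j]%SET.

(** Sum over the graphs of [S] with nonzero weight; it is an honest finite sum
    when [S] is finite, see [finite_Uset] below. *)
Definition Zsum (S : set (mgraph n)) : A := \sum_(F \in S) weight F.

End Weights.

(** ** Finiteness of Uset and existence of the 2-core *)

Lemma mult_cycle_graph_le2 c e : is_cycle c -> (mult (cycle_graph c) e <= 2)%N.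
Proof.
move=> /andP[uc _]; rewrite /mult /= ffunE count_map -size_filter.
set s := filter _ c.
case Es: s => [//|x s']; rewrite -Es.
have us : uniq s by exact: filter_uniq.
have xs : x \in s by rewrite Es mem_head.
have sub : {subset s <= [set x; next c x]%SET}.
  move=> y; rewrite mem_filter /= => /andP[/eqP ye _].
  move: xs; rewrite mem_filter /= => /andP[/eqP xe _].
  by rewrite xe -ye !inE eqxx.
rewrite -(card_uniqP us) (leq_trans (subset_leq_card (introT fintype.subsetP sub)))//.
by rewrite cards2; case: (_ != _).
Qed.

Lemma finite_Uset G (H0 : mgraph n) (l : 'I_(n.-1) -> nat) : finite_set (Uset G H0 l).
Proof.
pose B := (nedges H0 + n * 2)%N.
pose T := ({set 'I_n} * {ffun {set 'I_n} -> 'I_B.+1})%type.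
pose f (p : T) : mgraph n := (p.1, [ffun e => nat_of_ord (p.2 e)]).
apply: (@sub_finite_set _ _ (f @` setT)); last first.
  by apply: finite_image; exact: (@finite_finset T).
move=> F [mF _ lF _ [C [[sC mC maxC] [cs [[cyc ucs _] _ eC _ _]] cwf]]].
suff bF e : (mult F e <= B)%N.
  exists (F.1, [ffun e => inord (mult F e)]) => //.
  rewrite /f /= [RHS]surjective_pairing; congr pair.
  by apply/ffunP => e; rewrite !ffunE inordK ?ltnS ?bF.
have scs : (size cs <= n)%N.
  apply: (@leq_trans (size (flatten cs))); last first.
    by rewrite -(card_uniqP ucs) (leq_trans (max_card _)) ?card_ord.
  move: cyc; elim: (cs) => //= c cs' IH /andP[/andP[_ c0] /IH IH'].
  by rewrite size_cat -add1n leq_add.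
have bC : (mult C e <= B)%N.
  rewrite eC leq_add//; first by rewrite /nedges (bigD1 e)//= leq_addr.
  apply: (@leq_trans (\sum_(c <- cs) 2)).
    rewrite big_seq [leqRHS]big_seq leq_sum// => c ccs.
    by apply: mult_cycle_graph_le2; exact: (allP cyc).
  by rewrite big_const_seq count_predT iter_addn_0 mulnC leq_mul2r scs orbT.
have [F2|F2] := leqP 2 (mult F e); last first.
  have [F0|F1] := posnP (mult F e); first by rewrite F0.
  have Fe : mult F e = 1%N by apply/eqP; rewrite eqn_leq F1 -ltnS F2.
  rewrite Fe.
  have [ev ec] := mF _ F1.
  rewrite /B; case: (posnP n) => [n0|n0]; last by rewrite addn_gt0 muln_gt0 n0 orbT.
  move: ec => /andP[/card_gt0P[x _] _].
  by case: x => m; rewrite {1}n0.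
pose C' : mgraph n := (e, [ffun e' => if e' == e then mult F e else 0%N]).
have [eF ecard] := mF e (leq_trans (isT : 0 < 2)%N F2).
have sC' : subgraph C' F.
  split=> //= e'; rewrite /mult ffunE; case: eqP => // -> //.
have mC' : min_degree2 C'.
  move=> x /= xe; rewrite (bigD1 e)//= {1}/mult ffunE eqxx.
  by rewrite (leq_trans F2)// leq_addr.
have [_ _ /(_ e)] := maxC _ sC' mC'.
by rewrite {1}/mult ffunE eqxx => /leq_trans; apply.
Qed.

Lemma core2_exists F : is_mgraph F -> exists C, is_core2 C F.
Proof.
move=> mF.
pose ind (W : {set 'I_n}) : mgraph n :=
  (W, [ffun e : {set 'I_n} => if e \subset W then mult F e else 0%N]).
pose good (W : {set 'I_n}) := (W \subset vert F) &&
  [forall x in W, 2 <= \sum_(e : {set 'I_n} | x \in e) mult (ind W) e]%N.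
have indS (W W' : {set 'I_n}) e : W \subset W' ->
    (mult (ind W) e <= mult (ind W') e)%N.
  move=> sW; rewrite /mult /= !ffunE; case: ifP => // eW.
  by rewrite (fintype.subset_trans eW sW).
pose V := \bigcup_(W | good W) W.
exists (ind V); split.
- split=> [e||e].
  + rewrite {1}/mult /= ffunE; case: ifP => // eV F0.
    by have [_ ->] := mF e F0.
  + by apply/finset.bigcupsP => W /andP[].
  + by rewrite {1}/mult /= ffunE; case: ifP.
- move=> x /finset.bigcupP[W gW xW].
  have := gW => /andP[_ /forall_inP/(_ x xW)/leq_trans]; apply.
  by apply: leq_sum => e _; apply: indS; exact: finset.bigcup_sup.
- move=> C [mC vC sC] dC.
  have CW e : (mult C e <= mult (ind (vert C)) e)%N.
    have [->//|C0] := posnP (mult C e).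
    by have [eC _] := mC e C0; rewrite {2}/mult /= ffunE eC.
  have gC : good (vert C).
    rewrite /good vC; apply/forall_inP => x xC.
    by rewrite (leq_trans (dC x xC))// leq_sum.
  split=> // [|e]; first exact: (finset.bigcup_sup (vert C)).
  by rewrite (leq_trans (CW e))//; apply: indS; exact: (finset.bigcup_sup (vert C)).
Qed.

End Graphs.

(* Main.v *)
Require Import Defs.
From mathcomp Require Import fintype finset fingraph.
From mathcomp Require finmap.

Set Implicit Arguments.
Unset Strict Implicit.
Unset Printing Implicit Defensive.

Import GRing.Theory.
Local Open Scope nat_scope.
Local Open Scope set_scope.

(** Both sides are sums over the same objects: the maps g from the vertex set
  to itself whose fixed points are exactly the vertices of H0.

  Left side.  A regular digraph of the prescribed form is an orientation Q0 of
  H0 without sources and sinks together with the arcs (x, s x), x outside H0,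
  of a permutation s that fixes H0 and has k_s cycles of each length s >= 2;
  the fixed points of s outside H0 are the loops ([regular_formP]).  In its
  weight every loop contributes a diagonal entry of the Laplacian, the sum of
  the w x m over m <> x.  Expanding these sums chooses an m for every loop;
  with the arcs of s the choices form a map g as above, and s consists of some
  of the cycles of g.  Conversely a given g arises from a choice of k_s among
  its l_s cycles of length s, that is, in prod_s C(l_s, k_s) ways
  ([card_sub_perm]).  So rho is (-1)^e(H) d(H0) times the sum over g of
  prod_s C(l_s, k_s) times the weight of the graph
  F(g) = H0 + {edges {x, g x} : x outside H0} ([rho_maps]).

  Right side.  The graphs of U(H0 + 2^(l_2) .. n^(l_n)) are exactly the F(g)
  that lie over G, where g has l_s cycles of length s.  The 2-core of F(g)
  consists of H0 and the cycles of g: outside of it, a point without a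
  preimage is a leaf ([graph_of_map_Uset]).  Conversely every tree of a graph F
  in U is oriented towards its root in the 2-core, and every cycle is oriented
  in one of its directions ([Uset_graph_of_map], [forest_parent]).  Two maps
  have the same graph iff they differ by reversing some of the cycles of
  length >= 3 ([map_edges_rigid]), so each F comes from 2^(l_3 + .. + l_n)
  maps ([card_same_edges]).  Hence 2^(l_3 + .. + l_n) Z(U) is the sum of the
  weights of F(g) over the maps g with cycle numbers l ([Zsum_maps]), and
  sorting the maps on the left by their cycle numbers gives the theorem. *)

(** * Periodic points and cycles of a self-map of a finite set *)

Section SelfMaps.
Context {T : finType}.
Implicit Types (g h : T -> T) (x y : T) (B D S : {set T}).

Definition periodic h : {set T} := [set x | fconnect h (h x) x].

Definition orbset h x : {set T} := [set y | fconnect h x y].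

Lemma fconnect_iterP h x y : reflect (exists k, y = iter k h x) (fconnect h x y).
Proof.
apply: (iffP idP) => [/iter_findex <-|[k ->]]; last exact: fconnect_iter.
by exists (findex h x y).
Qed.

Lemma orbset_refl h x : x \in orbset h x.
Proof. by rewrite inE connect0. Qed.

Lemma orbset_step h x y : y \in orbset h x -> h y \in orbset h x.
Proof. by rewrite !inE => /connect_trans; apply; exact: fconnect1. Qed.

Lemma orbset_sub h S x : {homo h : y / y \in S} -> x \in S -> orbset h x \subset S.
Proof.
move=> hS xS; apply/subsetP => y; rewrite inE => /fconnect_iterP[k ->].
by elim: k => //= k; apply: hS.
Qed.

Lemma periodic_orbset h x y : x \in periodic h -> y \in orbset h x ->
  y \in periodic h /\ orbset h y = orbset h x.
Proof.
rewrite !inE !fconnect_f !fconnect_orbit => cx yx; split.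
  exact: cycle_orbit_cycle cx _ yx.
apply/setP => z; rewrite !inE (fconnect_cycle cx yx).
by rewrite (fconnect_cycle cx) // in_orbit.
Qed.

Lemma periodic_step h : {homo h : x / x \in periodic h}.
Proof.
by move=> x xP; case: (periodic_orbset xP (orbset_step (orbset_refl h x))).
Qed.

(** Two periodic points with the same image lie on the cycle of this image,
  and a map permutes each of its cycles. *)
Lemma periodic_inj h : {in periodic h &, injective h}.
Proof.
move=> x y xP yP e; have : fcycle h (orbit h (h x)).
  by rewrite -fconnect_f; have := periodic_step xP; rewrite inE.
move/inj_cycle; apply=> //; rewrite -fconnect_orbit ?e; first by move: xP; rewrite inE e.
by move: yP; rewrite inE.
Qed.

Lemma stable_periodic h S :
  {homo h : x / x \in S} -> {in S &, injective h} -> S \subset periodic h.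
Proof.
move=> hS iS; apply/subsetP => x xS; rewrite inE (fconnect_sym_in hS iS) ?hS//.
exact: fconnect1.
Qed.

Lemma periodicT h : injective h -> periodic h = setT.
Proof.
move=> ih; apply/eqP; rewrite eqEsubset subsetT /=.
by apply: stable_periodic => // x y _ _; apply: ih.
Qed.

Lemma fix_periodic h x : h x = x -> x \in periodic h.
Proof. by move=> hx; rewrite inE hx connect0. Qed.

(** The orbit of x is finite, so it returns to one of its points. *)
Lemma eventually_periodic h x : exists k, iter k h x \in periodic h.
Proof.
have /trajectP[i i_lt e] := looping_order h x.
exists i; rewrite inE; apply/fconnect_iterP; exists (order h x - i).-1.
by rewrite -iterSr prednK ?subn_gt0// -iterD subnK // ltnW.
Qed.

(** Connectedness under a map only involves the values along the orbit, so it
  can be computed from any map that agrees with it on a stable set. *)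
Lemma orbset_agree h g S x :
  {homo h : y / y \in S} -> {in S, h =1 g} -> x \in S ->
  orbset h x = orbset g x /\ (x \in periodic h) = (x \in periodic g).
Proof.
move=> hS hg.
have agree k y : y \in S -> iter k h y = iter k g y /\ iter k h y \in S.
  move=> yS; elim: k => //= k [<- itS]; split; [exact: hg|exact: hS].
have E y : y \in S -> fconnect h y =1 fconnect g y.
  move=> yS z; apply/fconnect_iterP/fconnect_iterP => -[k ->]; exists k;
  by case: (agree k y yS).
move=> xS; split; first by apply/setP => z; rewrite !inE E.
by rewrite !inE -hg// E // hS.
Qed.

Definition inverse_on D g h := forall x, x \in D ->
  [/\ g x \in D, h x \in D, h (g x) = x & g (h x) = x].

Lemma inverse_on_sym D g h : inverse_on D g h -> inverse_on D h g.
Proof. by move=> i x /i[]. Qed.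

Lemma inverse_on_periodic D g h : inverse_on D g h -> D \subset periodic g.
Proof.
move=> i; apply: stable_periodic => [x /i[]//|x y xD yD e].
by case: (i x xD) (i y yD) => _ _ <- _ [_ _ <- _]; rewrite e.
Qed.

Lemma inverse_on_orbset D g h x : inverse_on D g h -> x \in D ->
  orbset g x = orbset h x.
Proof.
suff H g' h' : inverse_on D g' h' -> x \in D -> orbset g' x \subset orbset h' x.
  by move=> i xD; apply/eqP; rewrite eqEsubset !H //; apply: inverse_on_sym.
move=> i xD; apply/subsetP => y; rewrite !inE => /fconnect_iterP[k ->].
suff [itD itE] : iter k g' x \in D /\ iter k h' (iter k g' x) = x.
  have hD : {homo h' : z / z \in D} by move=> z /i[].
  have ih : {in D &, injective h'}.
    by move=> a b aD bD e; case: (i a aD) (i b bD) => _ _ _ <- [_ _ _ <-]; rewrite e.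
  by rewrite (fconnect_sym_in hD ih)//; apply/fconnect_iterP; exists k.
elim: k => //= k [itD itE]; case: (i _ itD) => gD _ hg _; split=> //.
by rewrite -iterS iterSr hg.
Qed.

(** The cycles of h inside D are traversed backwards by g, and a cycle of h
  that meets the stable set D lies in it; hence g and h have the same cycles
  as sets of points. *)
Lemma reversal_orbset D g h : inverse_on D g h -> {in ~: D, g =1 h} ->
  periodic g = periodic h /\ {in periodic g, orbset g =1 orbset h}.
Proof.
have half g' h' : inverse_on D g' h' -> {in ~: D, g' =1 h'} ->
    forall x, x \in periodic g' -> x \in periodic h' /\ orbset g' x = orbset h' x.
  move=> i e x xP; have [xD|xD] := boolP (x \in D).
    split; last exact: inverse_on_orbset i xD.
    by apply: (subsetP (inverse_on_periodic (inverse_on_sym i))).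
  have sub y : y \in orbset g' x -> y \notin D.
    move=> yx; apply: contra xD => yD.
    have [yP eyx] := periodic_orbset xP yx.
    have gD : {homo g' : z / z \in D} by move=> z /i[].
    by apply: (subsetP (orbset_sub gD yD)); rewrite eyx orbset_refl.
  have [-> <-] := @orbset_agree g' h' (orbset g' x) x (@orbset_step g' x)
    (fun y yx => e y (eq_ind_r is_true (sub y yx) (finset.in_setC y D))) (orbset_refl g' x).
  by [].
move=> i e; split; last by move=> x /(half _ _ i e)[].
have e' : {in ~: D, h =1 g} by move=> x /e.
apply/setP => x; apply/idP/idP; first by case/(half _ _ i e).
by case/(half _ _ (inverse_on_sym i) e').
Qed.

Definition orbits h S : {set {set T}} := orbset h @: S.

(** Only periodic points are meant: the points of the nontrivial cycles. *)
Definition moved h : {set T} := [set x in periodic h | h x != x].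

Definition cycles h := orbits h (moved h).

(** The shift by 2 is that of the index set 'I_(n.-1) of cycle lengths. *)
Definition cycle_type h s := #|[set c in cycles h | #|c| == s.+2]|.

Lemma orbits_partition h S : S \subset periodic h -> {homo h : x / x \in S} ->
  partition (orbits h S) S.
Proof.
move=> SP hS; apply/and3P; split.
- rewrite eqEsubset; apply/andP; split.
    apply/bigcupsP => _ /imsetP[x xS ->]; exact: orbset_sub.
  apply/subsetP => x xS; apply/bigcupP; exists (orbset h x); last exact: orbset_refl.
  exact: imset_f.
- apply/trivIsetP => _ _ /imsetP[x xS ->] /imsetP[y yS ->]; apply: contraR.
  case/pred0Pn => z /= /andP[zx zy].
  have [_ <-] := periodic_orbset (subsetP SP _ xS) zx.
  by have [_ <-] := periodic_orbset (subsetP SP _ yS) zy.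
- apply/negP => /imsetP[x _ /setP/(_ x)]; by rewrite orbset_refl inE.
Qed.

Lemma moved_step h : {homo h : x / x \in moved h}.
Proof.
move=> x; rewrite ![_ \in moved h]in_set => /andP[xP xm].
rewrite periodic_step //=; apply: contra xm => /eqP e.
by apply/eqP/(periodic_inj (periodic_step xP) xP).
Qed.

Lemma moved_periodic h : moved h \subset periodic h.
Proof. by apply/subsetP => x; rewrite inE => /andP[]. Qed.

Lemma cycles_partition h : partition (cycles h) (moved h).
Proof. exact: orbits_partition (moved_periodic h) (@moved_step h). Qed.

Lemma orbset1 h x : (#|orbset h x| == 1) = (h x == x).
Proof.
apply/eqP/eqP => [|hx].
  move=> /eqP/cards1P[z /setP E].
  have := E x; rewrite orbset_refl inE => /esym/eqP xz.
  by have := E (h x); rewrite orbset_step ?orbset_refl // inE -xz => /esym/eqP.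
apply/eqP/cards1P; exists x; apply/setP => y; rewrite !inE.
apply/fconnect_iterP/eqP => [[k ->]|->]; last by exists 0.
by elim: k => //= k ->.
Qed.

Lemma cycle_card h c : c \in cycles h -> 1 < #|c|.
Proof.
case/imsetP => x; rewrite inE => /andP[_ xm] ->; rewrite ltn_neqAle eq_sym orbset1 xm /=.
by apply/card_gt0P; exists x; apply: orbset_refl.
Qed.

(** A nontrivial cycle has at least 2 and at most m + 1 points. *)
Lemma cycle_index h m : #|T| <= m.+1 -> forall c, c \in cycles h ->
  exists s : 'I_m, forall s' : 'I_m, (#|c| == s'.+2) = (s' == s).
Proof.
move=> Tm c /cycle_card c2.
have cm : #|c| <= m.+1 := leq_trans (max_card _) Tm.
have lt : #|c|.-2 < m by case: #|c| c2 cm => [|[|k]].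
exists (Ordinal lt) => s; apply/eqP/eqP => [e|->]; first by apply: val_inj; rewrite /= e.
by rewrite /=; case: #|c| c2 => [|[|k]].
Qed.

Lemma card_moved h m : #|T| <= m.+1 ->
  #|moved h| = \sum_(s < m) s.+2 * cycle_type h s.
Proof.
move=> Tm; rewrite (card_partition (cycles_partition h)).
transitivity (\sum_(c in cycles h) \sum_(s < m | #|c| == s.+2) s.+2).
  apply: eq_bigr => c ch; have [s0 sE] := cycle_index Tm ch.
  by rewrite (big_pred1 s0) //; apply/eqP; rewrite sE.
rewrite (exchange_big_dep predT)//=; apply: eq_bigr => s _.
by rewrite sum_nat_const mulnC /cycle_type; congr (_ * _); apply: eq_card => c; rewrite !inE.
Qed.

End SelfMaps.

(** * The edges {x, g x} of a map determine it up to reversing cycles *)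

Section EdgeCount.
Context {T I : finType}.
Implicit Types (S : {set I}) (E : I -> {set T}) (e : {set T}).

(** The multiplicity of e in the multigraph whose edges are E i, i in S. *)
Definition ecount S E e := #|[set i in S | E i == e]|.

Lemma ecountE S E e : ecount S E e = \sum_(i in S) (E i == e).
Proof.
rewrite /ecount -sum1_card; under eq_bigl do rewrite inE.
by rewrite big_mkcondr; apply: eq_bigr => i _; case: (_ == _).
Qed.

Lemma ecount_gt0 S E e : 0 < ecount S E e -> exists2 i, i \in S & E i = e.
Proof. by case/card_gt0P => i; rewrite inE => /andP[iS /eqP]; exists i. Qed.

Lemma ecount_ge1 S E i : i \in S -> 0 < ecount S E (E i).
Proof. by move=> iS; apply/card_gt0P; exists i; rewrite inE iS eqxx. Qed.

Lemma eq_ecount S E E' e : {in S, E =1 E'} -> ecount S E e = ecount S E' e.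
Proof. by move=> H; rewrite !ecountE; apply: eq_bigr => i /H ->. Qed.

Lemma ecountU S S' E e : [disjoint S & S'] ->
  ecount (S :|: S') E e = ecount S E e + ecount S' E e.
Proof. by move=> d; rewrite !ecountE -bigU //=; apply: eq_bigl => i; rewrite !inE. Qed.

End EdgeCount.

Section Rigidity.
Context {T : finType}.
Implicit Types (g h : T -> T) (x y : T) (D S : {set T}) (B : {set {set T}}).

Definition map_edges S g := ecount S (fun x => [set x; g x]).

Lemma set2_inj (x : T) : injective (fun y => [set x; y]).
Proof.
move=> y z /setP E; have := E y; have := E z.
rewrite !inE !eqxx !orbT; case: (eqVneq z x) => [->|_] /=.
  by move=> _ /esym; rewrite orbb => /eqP.
by move=> /eqP ->.
Qed.

(** The edge {x, g x} must be {j, h j} for some j in S.  If g x <> h x then j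
  cannot be x, hence j = g x and h takes g x back to x. *)
Lemma map_edges_rigid_half S g h x : map_edges S g =1 map_edges S h ->
  x \in S -> g x != h x -> [/\ g x \in S, g (g x) != h (g x) & h (g x) = x].
Proof.
move=> E xS gh.
have xg : g x != x.
  apply: contra gh => /eqP gx.
  have : 0 < map_edges S h [set x; g x] by rewrite -E; apply: ecount_ge1.
  case/ecount_gt0 => j jS; rewrite gx => /setP e.
  have jx : j = x by apply/eqP; have := e j; rewrite !inE eqxx orbb.
  by have := e (h j); rewrite !inE eqxx orbT jx orbb eq_sym.
have [gS hg] : g x \in S /\ h (g x) = x.
  have : 0 < map_edges S h [set x; g x] by rewrite -E; apply: ecount_ge1.
  case/ecount_gt0 => j jS e; have : j \in [set x; g x] by rewrite -e set21.
  rewrite !inE => /orP[/eqP jx|/eqP jg].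
    by move: gh; rewrite jx in e; rewrite (set2_inj e) eqxx.
  by split; rewrite -jg //; apply: (@set2_inj (g x)); rewrite -jg e jg setUC.
split=> //; apply: contra gh; rewrite hg => /eqP gg.
(* If g (g x) = h (g x) = x then the edge {x, g x} is double for g, so it is
   double for h as well; its only possible sources are x and g x, so that
   h x = g x after all. *)
have sub : [set x; g x] \subset [set y in S | [set y; g y] == [set x; g x]].
  by apply/subsetP => y; rewrite !inE => /orP[]/eqP->; rewrite ?xS ?gS ?gg ?eqxx// setUC eqxx.
have le2 : 2 <= map_edges S h [set x; g x].
  by rewrite -E; have := subset_leq_card sub; rewrite cards2 eq_sym xg.
have sub' : [set y in S | [set y; h y] == [set x; g x]] \subset [set x; g x].
  by apply/subsetP => y; rewrite inE => /andP[_ /eqP <-]; rewrite set21.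
have : x \in [set y in S | [set y; h y] == [set x; g x]].
  have /eqP-> : [set y in S | [set y; h y] == [set x; g x]] == [set x; g x].
    by rewrite eqEcard sub' cards2 eq_sym xg.
  exact: set21.
by rewrite inE => /andP[_ /eqP/set2_inj->].
Qed.

(** Equal edge multisets force g and h to be inverse to each other wherever
  they differ: cycles may be reversed, but nothing else can change. *)
Lemma map_edges_rigid S g h : map_edges S g =1 map_edges S h ->
  inverse_on [set x in S | g x != h x] g h.
Proof.
move=> E x; rewrite inE => /andP[xS gh].
have [gS gn hg] := map_edges_rigid_half E xS gh.
rewrite eq_sym in gh.
have [hS hn gh'] := map_edges_rigid_half (fsym E) xS gh.
by rewrite !inE gS gn hS eq_sym hn.
Qed.

(** On D the edge that g attaches to h x is the one that h attaches to x, so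
  the edges are merely relabelled along h. *)
Lemma map_edges_reversal D S g h : inverse_on D g h -> D \subset S ->
  {in S :\: D, g =1 h} -> map_edges S g =1 map_edges S h.
Proof.
move=> i DS gh e; rewrite /map_edges -(setID S D) (setIidPr DS).
have dj : [disjoint D & S :\: D].
  by rewrite disjoints_subset setCD subsetUr.
rewrite !ecountU //; congr (_ + _); last by apply: eq_ecount => x /gh ->.
rewrite !ecountE (reindex_onto h g) /=; last by move=> x /i[].
apply: eq_big => x; last by case/andP => _ /eqP ->; rewrite setUC.
apply/andP/idP => [[/i[_ _ _ +] /eqP <-] //|/i[_ hD _ gx]]; last by rewrite hD gx.
Qed.

(** Since g and h differ by reversals only, they have the same cycles. *)
Lemma rigid_cycles S g h : map_edges S g =1 map_edges S h ->
  {in ~: S, g =1 h} ->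
  periodic g = periodic h /\ cycles g = cycles h.
Proof.
move=> E gh; set D := [set x in S | g x != h x].
have i : inverse_on D g h by apply: map_edges_rigid.
have e : {in ~: D, g =1 h}.
  move=> x; rewrite !inE; case: (boolP (x \in S)) => [_ /negPn/eqP//|xS _].
  by apply: gh; rewrite inE.
have [P O] := reversal_orbset i e.
have M : moved g = moved h.
  apply/setP => x; rewrite [x \in moved g]in_set [x \in moved h]in_set -P.
  apply: andb_id2l => xP; have := O x xP.
  by rewrite -!orbset1 => ->.
split=> //; rewrite /cycles /orbits -M; apply: eq_in_imset => x xM.
by apply: O; apply: (subsetP (moved_periodic g)).
Qed.

End Rigidity.

(** * Retaining or reversing some of the cycles of a map *)

Section CycleSubsets.
Context {T : finType}.
Implicit Types (g h : T -> T) (x y : T) (D S : {set T}) (B : {set {set T}}).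

Definition perm_on_cycles h B x := if x \in cover B then h x else x.

(** The map [finv h], pointwise an iterate of h, is inverse to h on each cycle
  of h. *)
Definition reverse_cycles h B x := if x \in cover B then finv h x else h x.

Definition long_cycles h := [set c in cycles h | 2 < #|c|].

Lemma cycles_sub_moved h B : B \subset cycles h -> cover B \subset moved h.
Proof.
move=> sB; rewrite -(cover_partition (cycles_partition h)).
apply/bigcupsP => c /(subsetP sB) ch; exact: bigcup_sup.
Qed.

Lemma cycles_orbset h c x : c \in cycles h -> x \in c -> orbset h x = c.
Proof.
case/imsetP => y /(subsetP (moved_periodic h)) yP -> xy.
by case: (periodic_orbset yP xy).
Qed.

(** A set of cycles can be recovered from the set of its points. *)
Lemma orbits_cover h B : B \subset cycles h -> orbits h (cover B) = B.
Proof.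
move=> sB; apply/setP => c; apply/imsetP/idP => [[x /bigcupP[c' c'B xc'] ->]|cB].
  by rewrite (cycles_orbset (subsetP sB _ c'B) xc').
have ch := subsetP sB _ cB; have /card_gt0P[x xc] := ltnW (cycle_card ch).
exists x; last by rewrite (cycles_orbset ch xc).
by apply/bigcupP; exists c.
Qed.

Lemma cover_step h B : B \subset cycles h -> {homo h : x / x \in cover B}.
Proof.
move=> sB x /bigcupP[c cB xc]; apply/bigcupP; exists c => //.
by rewrite -(cycles_orbset (subsetP sB _ cB) xc) orbset_step ?orbset_refl.
Qed.

Lemma cover_periodic h B : B \subset cycles h -> cover B \subset periodic h.
Proof.
by move=> sB; apply: subset_trans (cycles_sub_moved sB) (moved_periodic h).
Qed.

Lemma cover_inverse h B : B \subset cycles h -> inverse_on (cover B) (finv h) h.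
Proof.
move=> sB x xB; have xP := subsetP (cover_periodic sB) _ xB.
have hP := @periodic_step T h; have iP := @periodic_inj T h.
split; [apply: finv_in xB|apply: cover_step xB|apply: f_finv_in xP|apply: finv_f_in xP] => //.
exact: cover_step.
Qed.

Lemma moved_perm_on_cycles h B : B \subset cycles h -> moved (perm_on_cycles h B) = cover B.
Proof.
move=> sB; apply/setP => x; rewrite [LHS]in_set /perm_on_cycles.
case: ifP => xB; rewrite ?eqxx ?andbF //.
have hm : {in cover B, h =1 perm_on_cycles h B} by move=> y; rewrite /perm_on_cycles => ->.
have [_ <-] := orbset_agree (cover_step sB) hm xB.
by have := subsetP (cycles_sub_moved sB) _ xB; rewrite inE.
Qed.

Lemma cycles_perm_on_cycles h B : B \subset cycles h -> cycles (perm_on_cycles h B) = B.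
Proof.
move=> sB; rewrite /cycles moved_perm_on_cycles // -[RHS](orbits_cover sB).
have hm : {in cover B, h =1 perm_on_cycles h B} by move=> y; rewrite /perm_on_cycles => ->.
apply: eq_in_imset => x xB.
by have [-> _] := orbset_agree (cover_step sB) hm xB.
Qed.

Lemma perm_on_cycles_inj h B : B \subset cycles h -> injective (perm_on_cycles h B).
Proof.
move=> sB x y; rewrite /perm_on_cycles; have cS := cover_step sB.
case: ifP => xB; case: ifP => yB //.
- by apply: periodic_inj; apply: (subsetP (cover_periodic sB)).
- by move=> e; have := cS _ xB; rewrite e yB.
- by move=> e; have := cS _ yB; rewrite -e xB.
Qed.

(** An injective map that agrees with h wherever it moves a point is made of
  whole cycles of h. *)
Lemma sub_permutation g h : injective g -> (forall x, g x != x -> g x = h x) ->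
  cycles g \subset cycles h /\ g =1 perm_on_cycles h (cycles g).
Proof.
move=> ig gh.
have Mg x : (x \in moved g) = (g x != x) by rewrite inE periodicT // inE.
have gh' : {in moved g, g =1 h} by move=> x; rewrite Mg => /gh.
split; last first.
  move=> x; rewrite /perm_on_cycles (cover_partition (cycles_partition g)) Mg.
  by case: ifPn => [/gh|/negPn/eqP].
apply/subsetP => _ /imsetP[x xM ->].
have [-> P] := orbset_agree (@moved_step _ g) gh' xM.
apply: imset_f; rewrite inE -P -gh' // -Mg xM andbT.
exact: (subsetP (moved_periodic g)).
Qed.

Lemma reverse_cycles_edges h B S : B \subset cycles h -> moved h \subset S ->
  map_edges S (reverse_cycles h B) =1 map_edges S h.
Proof.
move=> sB MS; have CS := subset_trans (cycles_sub_moved sB) MS.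
apply: (map_edges_reversal (D := cover B)) => // [x xB|x]; last first.
  by rewrite inE /reverse_cycles => /andP[/negbTE ->].
have [fB hB hf fh] := cover_inverse sB xB.
by split; rewrite /reverse_cycles ?xB ?hB.
Qed.

(** Length 3 is where a cycle differs from its reversal. *)
Lemma orbset_gt2 h x : x \in periodic h ->
  (2 < #|orbset h x|) = (h x != x) && (h (h x) != x).
Proof.
move=> xP; have [hx|hx] := eqVneq (h x) x.
  by have := orbset1 h x; rewrite hx eqxx => /eqP ->.
have [hhx|hhx] /= := eqVneq (h (h x)) x.
  apply/negbTE; rewrite -leqNgt; apply: (@leq_trans #|[set x; h x]|).
    apply: subset_leq_card; apply: orbset_sub; last exact: set21.
    by move=> y; rewrite !inE => /orP[]/eqP->; rewrite ?eqxx ?hhx ?eqxx ?orbT.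
  by rewrite cards2; case: (_ != _).
apply: (@leq_trans #|[set h (h x); h x; x]|).
  have hh : h (h x) != h x.
    apply: contra hx => /eqP/(periodic_inj (periodic_step xP) xP) ->.
    exact: eqxx.
  by rewrite -setUA cardsU1 cards2 !inE hx negb_or hh hhx.
apply: subset_leq_card; apply/subsetP => y; rewrite !inE => /orP[/orP[]|] /eqP->.
- exact: (fconnect_iter h 2).
- exact: fconnect1.
- exact: connect0.
Qed.

(** A cycle of length at least 3 changes at every point when reversed, so the
  set of reversed cycles can be read off from the reversed map. *)
Lemma reverse_cycles_diff h B : B \subset long_cycles h ->
  [set x | reverse_cycles h B x != h x] = cover B.
Proof.
move=> sB; have sB' : B \subset cycles h.
  by apply: subset_trans sB _; apply/subsetP => c; rewrite inE => /andP[].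
apply/setP => x; rewrite inE /reverse_cycles; case: ifP => xB; rewrite ?eqxx //.
have [_ _ hf _] := cover_inverse sB' xB.
case/bigcupP: (xB) => c cB xc; have := subsetP sB _ cB; rewrite inE => /andP[ch].
have xP := subsetP (cover_periodic sB') _ xB.
rewrite -(cycles_orbset ch xc) orbset_gt2 // => /andP[_].
by apply: contra => /eqP <-; rewrite hf.
Qed.

(** The set D on which g and h differ is stable under both; the cycles of h
  that it consists of have length at least 3, as a cycle of length 2 is its own
  reversal. *)
Lemma same_edges_reversal g h S : map_edges S g =1 map_edges S h -> {in ~: S, g =1 h} ->
  S = [set x | h x != x] ->
  exists2 B : {set {set T}}, B \subset long_cycles h & g =1 reverse_cycles h B.
Proof.
move=> E gh defS; set D := [set x in S | g x != h x].
have i : inverse_on D g h by apply: map_edges_rigid.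
have DP : D \subset periodic h := inverse_on_periodic (inverse_on_sym i).
have hD : {homo h : x / x \in D} by move=> x /i[].
have cD := cover_partition (orbits_partition DP hD).
exists (orbits h D).
  apply/subsetP => _ /imsetP[x xD ->].
  have [_ hxD _ ghx] := i x xD; have xP := subsetP DP _ xD.
  have hx : h x != x by move: xD; rewrite inE defS inE => /andP[].
  rewrite inE orbset_gt2 // hx; apply/andP; split.
    by apply: imset_f; rewrite in_set xP hx.
  by move: hxD; rewrite inE => /andP[_]; rewrite ghx eq_sym.
move=> x; rewrite /reverse_cycles cD; case: ifPn => xD.
  have [gD _ hg _] := i x xD.
  have PS := @periodic_step _ h; have PI := @periodic_inj _ h.
  have xP := subsetP DP _ xD.
  apply: (PI); [exact: (subsetP DP)| exact: finv_in|].
  by rewrite hg (f_finv_in PS PI xP).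
move: xD; rewrite inE negb_and => /orP[xS|/negPn/eqP //].
by apply: gh; rewrite inE.
Qed.

End CycleSubsets.

(** * Counting sub-permutations and reversals *)

(** The relation r sorts the elements of P into classes indexed by I, and B is
  drawn from each class separately. *)
Lemma card_stratified_draws (I U : finType) (P : {set U}) (r : I -> pred U) (k : I -> nat) :
  (forall u, u \in P -> exists i, forall j, r j u = (j == i)) ->
  #|[set B : {set U} | (B \subset P) && [forall i, #|[set u in B | r i u]| == k i]]| =
    \prod_i 'C(#|[set u in P | r i u]|, k i).
Proof.
move=> rP; pose F i := [set A : {set U} | A \subset [set u in P | r i u] & #|A| == k i].
have cF : #|family F| = \prod_i 'C(#|[set u in P | r i u]|, k i).
  rewrite card_family foldrE big_map big_enum /=; apply: eq_bigr => i _.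
  by rewrite cards_draws.
pose union (f : {ffun I -> {set U}}) := \bigcup_i f i.
have strat f : f \in family F -> forall i, [set u in union f | r i u] = f i.
  move=> /familyP fF i; have sF j u : u \in f j -> u \in P /\ r j u.
    by move: (fF j); rewrite inE => /andP[/subsetP s _] /s; rewrite inE => /andP[].
  apply/setP => u; rewrite inE; apply/andP/idP => [[/bigcupP[j _ uj] ri]|ui].
    have [uP rj] := sF _ _ uj; have [i0 ri0] := rP u uP.
    by move: ri rj; rewrite !ri0 => /eqP-> /eqP <-.
  by have [_ ->] := sF _ _ ui; split=> //; apply/bigcupP; exists i.
rewrite -cF -(card_in_imset (D := family F) (f := union)); last first.
  by move=> f f' fF fF' e; apply/ffunP => i; rewrite -!strat // e.
apply: eq_card => B; rewrite !inE; apply/andP/imsetP => [[sB /forallP kB]|[f fF ->]].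
  exists [ffun i => [set u in B | r i u]].
    apply/familyP => i; rewrite ffunE inE kB andbT; apply/subsetP => u.
    by rewrite !inE => /andP[/(subsetP sB) -> ->].
  apply/setP => u; apply/idP/bigcupP => [uB|[i _]]; last by rewrite ffunE inE => /andP[].
  have [i ri] := rP u (subsetP sB u uB).
  by exists i => //; rewrite ffunE inE uB ri eqxx.
split.
  apply/bigcupsP => i _; move/familyP/(_ i): fF; rewrite inE => /andP[/subset_trans s _].
  by apply: s; apply/subsetP => u; rewrite inE => /andP[].
apply/forallP => i; rewrite strat //.
by move/familyP/(_ i): fF; rewrite inE => /andP[].
Qed.

Section Counting.
Context {T : finType}.
Implicit Types (g h : T -> T) (x y : T) (D S : {set T}) (B : {set {set T}}).

Lemma fun_of_finfunK (R : Type) (f : T -> R) : ([ffun x => f x] : T -> R) = f.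
Proof. by apply/funext => x; rewrite ffunE. Qed.

(** The permutations that arise from some of the cycles of h. *)
Definition sub_perm g h := injectiveb g && [forall x, (g x != x) ==> (g x == h x)].

Definition has_cycle_type m g (k : 'I_m -> nat) := [forall s : 'I_m, cycle_type g s == k s].

(** A sub-permutation of h amounts to the set of its nontrivial cycles. *)
Lemma card_sub_perm h m (k : 'I_m -> nat) : #|T| <= m.+1 ->
  #|[set g : {ffun T -> T} | sub_perm g h && has_cycle_type g k]| =
    \prod_(s < m) 'C(cycle_type h s, k s).
Proof.
move=> Tm; rewrite /cycle_type.
rewrite -(card_stratified_draws (r := fun (s : 'I_m) (c : {set T}) => #|c| == s.+2)); last first.
  exact: cycle_index.
set X := [set B : {set {set T}} | _].
rewrite -[RHS](card_in_imset (D := X) (f := fun B => [ffun x => perm_on_cycles h B x])); last first.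
  move=> B B'; rewrite !inE => /andP[sB _] /andP[sB' _] e.
  have := congr1 (fun f : {ffun T -> T} => cycles f) e.
  by rewrite !fun_of_finfunK !cycles_perm_on_cycles.
apply: eq_card => g; rewrite inE; apply/idP/imsetP.
  case/andP => /andP[/injectiveP ig /forallP gh] kg.
  have gh' x : g x != x -> g x = h x by move=> gx; apply/eqP; exact: implyP (gh x) gx.
  have [sg eg] := sub_permutation ig gh'.
  exists (cycles g); last by apply/ffunP => x; rewrite ffunE eg.
  by rewrite inE sg.
case=> B; rewrite inE => /andP[sB kB] ->.
rewrite /sub_perm /has_cycle_type !fun_of_finfunK /cycle_type cycles_perm_on_cycles // kB andbT.
apply/andP; split; first by apply/injectiveP; apply: perm_on_cycles_inj.
by apply/forallP => x; rewrite /perm_on_cycles; case: ifP; rewrite ?eqxx ?implybT.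
Qed.

Definition same_edges g h :=
  [forall x, (g x == x) == (h x == x)] &&
  [forall e, map_edges [set x | h x != x] g e == map_edges [set x | h x != x] h e].

(** The maps with the edges of h are obtained by reversing a set of cycles of
  length at least 3, and different sets give different maps. *)
Lemma card_same_edges h m : #|T| <= m.+1 ->
  #|[set g : {ffun T -> T} | same_edges g h]| =
    2 ^ (\sum_(s < m | 3 <= s.+2) cycle_type h s).
Proof.
move=> Tm; set S := [set x | h x != x].
have -> : \sum_(s < m | 3 <= s.+2) cycle_type h s = #|long_cycles h|.
  rewrite -sum1_card (eq_bigr (fun s : 'I_m => \sum_(c in cycles h | #|c| == s.+2) 1)); last first.
    by move=> s _; rewrite sum1dep_card.
  rewrite (exchange_big_dep (mem (cycles h))) /=; last by move=> s c _ /andP[].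
  rewrite [RHS](eq_bigl (fun c => (c \in cycles h) && (2 < #|c|))); last by move=> c; rewrite inE.
  rewrite big_mkcondr; apply: eq_bigr => c ch.
  have [s0 sE] := cycle_index Tm ch.
  rewrite (eq_bigl (fun s => (s == s0) && (2 < #|c|))); last first.
    move=> s; rewrite ch /= sE andbC; case: eqP => //= ->.
    by have := sE s0; rewrite eqxx => /eqP ->.
  case: ifP => _; first by rewrite (big_pred1 s0) // => s; rewrite andbT.
  by rewrite big_pred0 // => s; rewrite andbF.
rewrite -card_powerset.
rewrite -[RHS](card_in_imset (D := powerset _)
  (f := fun B => [ffun x => reverse_cycles h B x])); last first.
  move=> B B'; rewrite !inE => sB sB' e.
  have lc : long_cycles h \subset cycles h by apply/subsetP => c; rewrite inE => /andP[].
  have := congr1 (fun f : {ffun T -> T} => orbits h [set x | f x != h x]) e.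
  rewrite !fun_of_finfunK !reverse_cycles_diff // !orbits_cover //; exact: subset_trans lc.
have MS : moved h \subset S by apply/subsetP => x; rewrite !inE => /andP[].
apply: eq_card => g; rewrite inE; apply/idP/imsetP.
  case/andP => /forallP fix_ /forallP E.
  have E' : map_edges S g =1 map_edges S h by move=> e; apply/eqP.
  have gh : {in ~: S, g =1 h}.
    by move=> x; rewrite !inE negbK => hx; have := fix_ x; rewrite hx (eqP hx) eqb_id => /eqP.
  have [B sB gB] := same_edges_reversal E' gh erefl.
  by exists B; [rewrite inE|apply/ffunP => x; rewrite ffunE gB].
case=> B; rewrite inE => sB ->.
have sB' : B \subset cycles h.
  by apply: subset_trans sB _; apply/subsetP => c; rewrite inE => /andP[].
rewrite /same_edges fun_of_finfunK; apply/andP; split; apply/forallP => x; last first.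
  by rewrite reverse_cycles_edges.
rewrite /reverse_cycles; case: ifP => // xB; have [_ _ hf _] := cover_inverse sB' xB.
have := subsetP (cycles_sub_moved sB') _ xB; rewrite inE => /andP[_ hx].
rewrite (negbTE hx); apply/eqP; apply/negbTE; apply: contra hx => /eqP fx.
by rewrite -{1}fx hf.
Qed.

End Counting.

(** * Disjoint cycles in a graph and injective maps *)

(** This count of points determines the cycle type and is easier to compare
  with a list of cycles than the set of cycles itself. *)
Lemma card_orbset_points (T : finType) (h : T -> T) s :
  #|[set x in periodic h | #|orbset h x| == s.+2]| = s.+2 * cycle_type h s.
Proof.
set S := [set x in _ | _].
have SP : S \subset periodic h by apply/subsetP => x; rewrite inE => /andP[].
have hS : {homo h : x / x \in S}.
  move=> x; rewrite [x \in S]in_set [h x \in S]in_set => /andP[xP xs].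
  by have [-> ->] := periodic_orbset xP (orbset_step (orbset_refl h x)).
rewrite (card_uniform_partition (n := s.+2) _ (orbits_partition SP hS)); last first.
  by move=> _ /imsetP[x + ->]; rewrite inE => /andP[_ /eqP].
rewrite mulnC; congr (_ * _); apply: eq_card => c; rewrite [RHS]inE.
apply/imsetP/andP => [[x + ->]|[/imsetP[x xM ->] xs]].
  rewrite [x \in S]in_set => /andP[xP xs]; split=> //; apply: imset_f.
  by rewrite in_set xP -orbset1 (eqP xs).
by exists x; rewrite // in_set xs (subsetP (moved_periodic h)).
Qed.

Section CycleLists.
Context {n : nat}.
Implicit Types (c : seq 'I_n) (cs : seq (seq 'I_n)) (g h : 'I_n -> 'I_n).

Definition follows g cs := forall c, c \in cs -> {in c, next c =1 g}.

Lemma cycle_graphs_edges cs g e : uniq (flatten cs) -> follows g cs ->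
  \sum_(c <- cs) mult (cycle_graph c) e = map_edges [set x in flatten cs] g e.
Proof.
move=> u f; rewrite /map_edges ecountE.
under [RHS]eq_bigl do rewrite inE.
rewrite -big_uniq // big_flatten /=; apply: eq_big_seq => c cc.
rewrite /mult /= ffunE count_map -sum1_count big_mkcond /=; apply: eq_big_seq => x xc.
by rewrite -(f c cc x xc); case: (_ == _).
Qed.

Lemma follows_fcycle g cs c : uniq (flatten cs) -> follows g cs -> c \in cs -> fcycle g c.
Proof.
move=> u f cc; have uc : uniq c.
  by move: u; rewrite (perm_uniq (perm_flatten (perm_to_rem cc))) cat_uniq => /andP[].
by apply: cycle_from_next => // x xc /=; rewrite (f c cc x xc).
Qed.

Lemma follows_orbset g cs c x : uniq (flatten cs) -> follows g cs -> c \in cs -> x \in c ->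
  #|orbset g x| = size c /\ x \in periodic g.
Proof.
move=> u f cc xc; have fc := follows_fcycle u f cc; split.
  have uc : uniq c.
    by move: u; rewrite (perm_uniq (perm_flatten (perm_to_rem cc))) cat_uniq => /andP[].
  rewrite -(card_uniqP uc); apply: eq_card => y.
  by rewrite inE (fconnect_cycle fc xc).
by rewrite inE (fconnect_cycle fc) // mem_fcycle.
Qed.

Lemma follows_points g cs m : uniq (flatten cs) -> follows g cs ->
  #|[set x in flatten cs | #|orbset g x| == m]| = m * count (fun c => size c == m) cs.
Proof.
move=> u f; rewrite -sum1_card.
under eq_bigl do rewrite inE.
rewrite big_mkcondr -big_uniq //= big_flatten /= -sum1_count big_distrr /= [RHS]big_mkcond.
apply: eq_big_seq => c cc; have [<-|nm] /= := eqVneq (size c) m.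
  rewrite muln1 -[RHS]sum1_size; apply: eq_big_seq => x xc.
  by have [-> _] := follows_orbset u f cc xc; rewrite eqxx.
rewrite big1_seq // => x /= xc.
by have [-> _] := follows_orbset u f cc xc; rewrite (negbTE nm).
Qed.

(** Remove the orbit of one point of S and continue with the remaining ones. *)
Lemma list_of_cycles h (S : {set 'I_n}) : S \subset periodic h ->
  {homo h : x / x \in S} -> exists cs,
  [/\ all is_cycle cs, uniq (flatten cs), flatten cs =i S & follows h cs].
Proof.
have [m] := ubnP #|S|; elim: m S => // m IH S; rewrite ltnS => Sm SP hS.
have [->|[x xS]] := set_0Vmem S.
  by exists [::]; split=> // x; rewrite inE.
have xP := subsetP SP _ xS.
have oS : orbset h x \subset S by apply: orbset_sub.
have fo : fcycle h (orbit h x) by rewrite -fconnect_f; have := xP; rewrite inE.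
have mo y : (y \in orbit h x) = (y \in orbset h x) by rewrite inE fconnect_orbit.
have [|||cs [cy u m_cs f]] := IH (S :\: orbset h x).
- apply: leq_trans Sm; rewrite -(cardsID (orbset h x) S) (setIidPr oS) -addn1 addnC leq_add2r.
  by apply/card_gt0P; exists x; apply: orbset_refl.
- by apply: subset_trans SP; apply: subsetDl.
- move=> y; rewrite !in_setD => /andP[yx yS]; rewrite hS // andbT.
  apply: contra yx => hyx; have [_ <-] := periodic_orbset xP hyx.
  have yP := subsetP SP _ yS; have [_ ->] := periodic_orbset yP (orbset_step (orbset_refl h y)).
  exact: orbset_refl.
exists (orbit h x :: cs); split=> /=.
- by rewrite cy /is_cycle orbit_uniq size_orbit order_gt0.
- rewrite cat_uniq orbit_uniq u andbT /=; apply/hasPn => y.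
  by rewrite m_cs mo inE => /andP[].
- move=> y; rewrite mem_cat mo m_cs in_setD; case: (boolP (y \in orbset h x)) => //= yx.
  by rewrite (subsetP oS).
move=> c; rewrite inE => /predU1P[->|/f//] y yo.
by have /= /eqP-> := next_cycle fo yo.
Qed.

(** The function [next c] fixes the points outside c, so the composition of
  these functions follows all the disjoint cycles at once. *)
Lemma map_of_cycles cs : all is_cycle cs -> uniq (flatten cs) ->
  exists g, [/\ injective g, forall x, x \notin flatten cs -> g x = x & follows g cs].
Proof.
elim: cs => [_ _|c cs IH /= /andP[/andP[uc _] /IH{}IH]].
  by exists id; split=> //; exact: inj_id.
rewrite cat_uniq => /and3P[_ /hasPn dj /IH[g [ig id_g f]]].
exists (next c \o g); split.
- by apply: inj_comp ig; apply: can_inj (prev_next uc).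
- move=> x; rewrite mem_cat negb_or => /andP[xc /id_g /= ->].
  by rewrite next_nth (negbTE xc).
move=> c'; rewrite inE => /predU1P[->|c'cs] x xc' /=.
  by rewrite id_g //; apply: contraL xc'; apply: dj.
rewrite -(f _ c'cs x xc') [RHS]next_nth ifN //; apply: dj.
by apply/flattenP; exists c'; rewrite // mem_next.
Qed.

(** Orienting the cycles turns the existential list of cycles into an
  injective map g, whose loops are the fixed points of g in S.  A cycle has two
  orientations, so g is not unique. *)
Lemma has_formP (H0 K : mgraph n) k1 (k : 'I_(n.-1) -> nat) :
  has_form H0 k1 k K <-> exists g (S : {set 'I_n}),
  [/\ injective g /\ (forall x, x \notin S -> g x = x),
     [disjoint vert H0 & S] /\ vert K = vert H0 :|: S,
     forall e, mult K e = mult H0 e + map_edges S g e,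
     #|[set x in S | g x == x]| = k1 & forall s : 'I_(n.-1), cycle_type g s = k s].
Proof.
split=> [[cs [[cy u dj] vK mK c1 ck]]|[g [S [[ig id_g] [dj vK] mK c1 ck]]]].
  have [g [ig id_g f]] := map_of_cycles cy u.
  exists g, [set x in flatten cs]; split=> //.
  - by split=> // x; rewrite inE; apply: id_g.
  - by move=> e; rewrite mK (cycle_graphs_edges e u f).
  - rewrite -c1 -[RHS]mul1n -(follows_points 1 u f).
    by apply: eq_card => x; rewrite !inE orbset1.
  move=> s; apply/eqP; rewrite -(eqn_pmul2l (ltn0Sn s.+1)) -ck -(follows_points _ u f).
  rewrite -card_orbset_points periodicT //; apply/eqP/eq_card => x; rewrite !inE /=.
  case: (boolP (x \in flatten cs)) => // /id_g gx.
  by have := orbset1 g x; rewrite gx eqxx => /eqP ->.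
have gS : {homo g : x / x \in S}.
  move=> x xS; apply: contraLR (xS) => gS; have /ig gx := id_g _ gS.
  by rewrite -gx.
have SP : S \subset periodic g by rewrite periodicT // subsetT.
have [cs [cy u m_cs f]] := list_of_cycles SP gS.
have eS : S = [set x in flatten cs] by apply/setP => x; rewrite inE m_cs.
exists cs; split; rewrite -?eS //.
- by move=> e; rewrite (cycle_graphs_edges e u f) -eS.
- rewrite -c1 -[LHS]mul1n -(follows_points 1 u f).
  by apply: eq_card => x; rewrite !inE orbset1 m_cs.
move=> s; apply/eqP; rewrite -(eqn_pmul2l (ltn0Sn s.+1)) -ck -(follows_points _ u f).
rewrite -card_orbset_points periodicT //; apply/eqP/eq_card => x; rewrite !inE /= m_cs.
case: (boolP (x \in S)) => // /id_g gx.
by have := orbset1 g x; rewrite gx eqxx => /eqP ->.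
Qed.

End CycleLists.

(** * Regular digraphs as an orientation of H0 and a permutation *)

Lemma sum_ecount (T I : finType) (S : {set I}) (E : I -> {set T}) :
  \sum_e ecount S E e = #|S|.
Proof.
under eq_bigr do rewrite ecountE.
rewrite exchange_big /= -sum1_card; apply: eq_bigr => i _.
by rewrite (bigD1 (E i)) //= eqxx big1 // => e; rewrite eq_sym => /negbTE ->.
Qed.

Section Orientations.
Context {n : nat}.
Implicit Types (Q : {set 'I_n * 'I_n}) (g h : 'I_n -> 'I_n) (S : {set 'I_n}).

Definition arc_edge (p : 'I_n * 'I_n) : {set 'I_n} := [set p.1; p.2].

Definition arcs S g : {set 'I_n * 'I_n} := [set (x, g x) | x in S].

Definition orientations (H0 : mgraph n) : {set {set 'I_n * 'I_n}} :=
  [set Q | (und (vert H0) Q == H0) && no_source_sink (vert H0) Q].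

Lemma mem_arcs S g x y : ((x, y) \in arcs S g) = (x \in S) && (y == g x).
Proof.
apply/imsetP/andP => [[z zS [-> ->]] //|[xS /eqP->]]; by exists x.
Qed.

Lemma arcs_inj_on S g : {in S &, injective (fun x => (x, g x))}.
Proof. by move=> x y _ _ []. Qed.

Lemma ecount_arcs S g e : ecount (arcs S g) arc_edge e = map_edges S g e.
Proof. by rewrite /map_edges !ecountE big_imset //=; apply: arcs_inj_on. Qed.

Lemma mult_und V Q e : mult (und V Q) e = ecount Q arc_edge e.
Proof. by rewrite /mult /und /= ffunE. Qed.

Lemma und_eqP (H0 : mgraph n) Q :
  reflect (forall e, mult H0 e = ecount Q arc_edge e) (und (vert H0) Q == H0).
Proof.
apply: (iffP eqP) => [<- e|E]; first by rewrite mult_und.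
rewrite [RHS]surjective_pairing; congr pair; apply/ffunP => e.
by have := E e; rewrite -(mult_und (vert H0)).
Qed.

(** As H0 has no multiple edges, an orientation has no antiparallel arcs. *)
Lemma orientation_arc (H0 : mgraph n) Q x y : negative H0 -> und (vert H0) Q == H0 -> (x, y) \in Q ->
  [/\ x \in vert H0, y \in vert H0, x != y & (y, x) \notin Q].
Proof.
case=> mg ll m1 _ _ /und_eqP E xyQ.
have pos : 0 < mult H0 [set x; y] by rewrite E; apply: (ecount_ge1 arc_edge xyQ).
have [sub _] := mg _ pos.
have xy : x != y by apply: contraTneq pos => ->; rewrite setUid ll.
split=> //; [by apply: (subsetP sub); rewrite set21|by apply: (subsetP sub); rewrite set22|].
apply/negP => yxQ; have := m1 [set x; y]; apply/negP; rewrite -ltnNge E.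
apply: (@leq_trans #|[set (x, y); (y, x)]|); first by rewrite cards2 xpair_eqE (negbTE xy).
apply: subset_leq_card; apply/subsetP => p; rewrite !inE => /orP[]/eqP->.
  by rewrite xyQ eqxx.
by rewrite yxQ /arc_edge /= setUC eqxx.
Qed.

Lemma component_sub Q S x p : (forall p, p \in Q -> (p.1 \in S) = (p.2 \in S)) ->
  x \in S -> p \in arcs_of_component Q x -> p.1 \in S.
Proof.
move=> QS xS; rewrite inE => /andP[_ c].
rewrite -(closed_connect _ c) //; move=> a b; rewrite /adj mult_und => /ecount_gt0[q qQ e].
have H z : z \in [set a; b] -> (z \in S) = (q.1 \in S).
  by rewrite -e !inE => /orP[]/eqP-> //; rewrite QS.
by rewrite !H ?set21 ?set22.
Qed.

(** H0 has neither loops nor double edges, no arc joins it to the other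
  vertices, and g permutes these; so a loop or an antiparallel pair is a cycle of g
  of length 1 or 2, which is a full component. *)
Lemma regular_union (H0 : mgraph n) Q0 g : negative H0 -> Q0 \in orientations H0 -> injective g ->
  (forall x, x \in vert H0 -> g x = x) -> regular (Q0 :|: arcs (~: vert H0) g).
Proof.
move=> neg; rewrite inE => /andP[uQ0 /forall_inP ns] ig gV.
have gT x : x \notin vert H0 -> g x \notin vert H0.
  by move=> xV; apply: contra (xV) => gxV; have /ig <- := gV _ gxV.
have comp S i p : {homo g : x / x \in S} -> S \subset ~: vert H0 -> i \in S ->
    p \in arcs_of_component (Q0 :|: arcs (~: vert H0) g) i -> p.1 \in S /\ p.2 = g p.1.
  move=> gS ST iS pc.
  (* As g is injective, the stable set S contains a point as soon as it contains
     its image. *)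
  have gSE x : (x \in S) = (g x \in S).
    apply/idP/idP => [/gS //|gxS]; have SP : S \subset periodic g by rewrite periodicT // subsetT.
    have gxP := subsetP SP _ gxS.
    have : x \in orbset g (g x).
      have xP : x \in periodic g by rewrite periodicT // inE.
      have [_ ->] := periodic_orbset xP (orbset_step (orbset_refl g x)); exact: orbset_refl.
    exact: (subsetP (orbset_sub gS gxS)).
  have p1S : p.1 \in S.
    apply: component_sub iS pc => -[a b]; rewrite in_setU mem_arcs /= => /orP[abQ|/andP[_ /eqP->] //].
    have [aV bV _ _] := orientation_arc neg uQ0 abQ.
    have nS z : z \in vert H0 -> z \in S = false.
      by move=> zV; apply: contraTF zV => /(subsetP ST); rewrite inE.
    by rewrite !nS.
  split=> //; move: pc; rewrite inE => /andP[+ _]; case: p p1S => a b /= aS.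
  rewrite in_setU mem_arcs => /orP[abQ|/andP[_ /eqP //]].
  have [aV _ _ _] := orientation_arc neg uQ0 abQ.
  by move: (subsetP ST _ aS); rewrite inE aV.
split.
- apply/forall_inP => x _; have [xV|xV] := boolP (x \in vert H0).
    have /andP[/existsP[y yx] /existsP[z xz]] := ns x xV.
    by apply/andP; split; apply/existsP; [exists y|exists z]; rewrite in_setU ?yx ?xz.
  apply/andP; split; apply/existsP; last first.
    by exists (g x); rewrite in_setU mem_arcs inE xV eqxx orbT.
  exists (finv g x); rewrite in_setU mem_arcs inE f_finv // eqxx andbT; apply/orP; right.
  by apply: contra xV => fV; rewrite -(f_finv ig x) gV.
- move=> i iQ; have [iV gi] : i \notin vert H0 /\ i = g i.
    move: iQ; rewrite in_setU mem_arcs inE => /orP[iQ|/andP[-> /eqP] //].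
    by have [_ _ /eqP] := orientation_arc neg uQ0 iQ.
  apply/setP => p; rewrite in_set1; apply/idP/eqP => [|->]; last by rewrite inE iQ connect0.
  move=> /(comp [set i] i); rewrite !inE => -[||//|].
  + by move=> x; rewrite !inE => /eqP->; rewrite -gi.
  + by rewrite sub1set inE.
  by case: p => a b /= /eqP-> ->; rewrite -gi.
move=> i j ij ijQ jiQ.
have [iV [jV [gi gj]]] : i \notin vert H0 /\ j \notin vert H0 /\ g i = j /\ g j = i.
  have key a b : (a, b) \in Q0 :|: arcs (~: vert H0) g -> (b, a) \in Q0 :|: arcs (~: vert H0) g ->
      a \notin vert H0 /\ g a = b.
    rewrite [in X in X -> _]in_setU mem_arcs inE => /orP[abQ|/andP[-> /eqP->] //].
    rewrite in_setU mem_arcs inE => /orP[baQ|/andP[bV _]].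
      by have [_ _ _ /negP[]] := orientation_arc neg uQ0 abQ.
    by have [_ bV'] := orientation_arc neg uQ0 abQ; rewrite bV' in bV.
  by have [? ?] := key _ _ ijQ jiQ; have [? ?] := key _ _ jiQ ijQ.
apply/setP => p; rewrite in_set2; apply/idP/orP => [|[]/eqP->].
- move=> /(comp [set i; j] i); rewrite !inE => -[||//|].
  + by move=> x; rewrite !inE => /orP[]/eqP->; rewrite ?gi ?gj eqxx ?orbT.
  + by apply/subsetP => x; rewrite !inE => /orP[]/eqP->.
  + by rewrite eqxx.
  by case: p => a b /= [/orP[]/eqP-> ->]; rewrite ?gi ?gj; [left|right].
- by rewrite inE ijQ connect0.
rewrite inE jiQ /=; apply: connect1; rewrite /adj mult_und.
exact: (ecount_ge1 arc_edge ijQ).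
Qed.

Lemma card_fixed_off (H0 : mgraph n) g (k : 'I_(n.-1) -> nat) : injective g ->
  (forall x, x \in vert H0 -> g x = x) -> has_cycle_type g k ->
  #|[set x in ~: vert H0 | g x == x]| = n - nvert_form H0 k.
Proof.
move=> ig gV /forallP ck.
have -> : nvert_form H0 k = #|vert H0| + #|moved g|.
  rewrite (@card_moved _ g n.-1); last by rewrite card_ord leqSpred.
  by congr (_ + _); apply: eq_bigr => s _; rewrite (eqP (ck s)).
have Vn : #|~: vert H0| = n - #|vert H0| by rewrite cardsCs setCK card_ord.
rewrite subnDA -Vn -(cardsID (moved g) (~: vert H0)).
have -> : ~: vert H0 :&: moved g = moved g.
  apply/setIidPr/subsetP => x; rewrite [x \in moved g]in_set in_setC => /andP[_].
  by apply: contra => /gV ->.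
rewrite addnC addnK; apply: eq_card => x; rewrite in_setD [x \in moved g]in_set [LHS]in_set.
by rewrite periodicT // in_setT /= negbK andbC.
Qed.

(** In the direct implication, every vertex outside H0 has an outgoing arc; as
  these vertices span as many edges as there are vertices, they have no other
  arcs.  The chosen outgoing arcs thus define a map with the edge multiset of
  disjoint cycles, hence, by rigidity, a permutation with the same cycles. *)
Lemma regular_formP (H0 : mgraph n) (k : 'I_(n.-1) -> nat) Q : negative H0 ->
  regular Q /\ has_form H0 (n - nvert_form H0 k) k (und setT Q) <->
  exists Q0 (g : {ffun 'I_n -> 'I_n}),
    [/\ Q0 \in orientations H0, injective g /\ has_cycle_type g k,
        forall x, x \in vert H0 -> g x = x & Q = Q0 :|: arcs (~: vert H0) g].
Proof.
move=> neg; have [mg ll m1 _ _] := neg.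
split=> [[[ns _ _] /has_formP[h [T [[ih id_h] [dj vT] mT _ kT]]]]|]; last first.
  case=> Q0 [g [oQ0 [ig kg] gV ->]]; split; first exact: regular_union.
  apply/has_formP; exists g, (~: vert H0); split.
  - by split=> // x; rewrite inE negbK; apply: gV.
  - by rewrite setUCr; split; rewrite // disjoints_subset setCK.
  - move=> e; rewrite mult_und ecountU.
      move: oQ0; rewrite inE => /andP[/und_eqP -> _]; by rewrite ecount_arcs.
    rewrite disjoints_subset; apply/subsetP => -[a b] abQ; rewrite inE mem_arcs inE.
    move: oQ0; rewrite inE => /andP[uQ0 _].
    by have [-> _ _ _] := orientation_arc neg uQ0 abQ.
  - exact: card_fixed_off.
  by move=> s; apply/eqP; apply: (forallP kg).
have eT : T = ~: vert H0.
  apply/setP => x; rewrite inE; apply/idP/idP => [xT|xV].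
    by apply: contraTN xT => /(disjointFr dj) ->.
  have : x \in vert (und setT Q) by rewrite inE.
  by rewrite vT inE (negbTE xV).
subst T; set T := ~: vert H0.
have hV x : x \in vert H0 -> h x = x by move=> xV; apply: id_h; rewrite inE negbK.
have hT x : x \in T -> h x \in T.
  by rewrite !inE; apply: contra => hxV; have /ih <- := hV _ hxV.
have mapT e : 0 < map_edges T h e -> e \subset T /\ exists x, x \in e.
  case/ecount_gt0 => x xT <-; split; last by exists x; rewrite set21.
  by apply/subsetP => y; rewrite in_set2 => /orP[]/eqP->//; apply: hT.
(* Every edge belongs to H0 or to one of the cycles, which avoid H0. *)
have arcQ p : p \in Q -> arc_edge p \subset vert H0 \/ arc_edge p \subset T.
  move=> pQ; have : 0 < mult (und setT Q) (arc_edge p) by rewrite mult_und ecount_ge1.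
  rewrite mT; case: (posnP (mult H0 (arc_edge p))) => [-> /mapT[sT _]|/mg[sV _] _]; by [right|left].
pose Q0 := [set p in Q | p.1 \in vert H0]; pose Q1 := [set p in Q | p.1 \in T].
have defQ : Q = Q0 :|: Q1 by apply/setP => p; rewrite !inE; case: (p \in Q) => //=; rewrite orbN.
have djQ : [disjoint Q0 & Q1].
  by rewrite disjoints_subset; apply/subsetP => p; rewrite !inE => /andP[-> ->].
have cQ e : ecount Q0 arc_edge e = mult H0 e /\ ecount Q1 arc_edge e = map_edges T h e.
  have := mT e; rewrite mult_und {1}defQ ecountU //.
  have [eV|eV] := boolP (e \subset vert H0).
    have -> : map_edges T h e = 0.
      apply/eqP; rewrite -leqn0 leqNgt; apply/negP => /mapT[/subsetP sT [x xe]].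
      by have := sT x xe; rewrite inE (subsetP eV).
    have -> : ecount Q1 arc_edge e = 0.
      apply/eqP; rewrite -leqn0 leqNgt; apply/negP => /ecount_gt0[p].
      rewrite !inE => /andP[_ pT] pe; move/negP: pT; apply.
      by apply: (subsetP eV); rewrite -pe set21.
    by rewrite !addn0.
  have -> : mult H0 e = 0.
    by apply/eqP; rewrite -leqn0 leqNgt; apply: contra eV => /mg[].
  have -> : ecount Q0 arc_edge e = 0.
    apply/eqP; rewrite -leqn0 leqNgt; apply: contra eV => /ecount_gt0[p].
    rewrite inE => /andP[pQ pV] <-; case: (arcQ p pQ) => // /subsetP/(_ p.1).
    by rewrite set21 inE pV => /(_ isT).
  by rewrite !add0n.
have ends_agree p : p \in Q -> (p.1 \in vert H0) = (p.2 \in vert H0).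
  move=> /arcQ[] /subsetP s; have := s p.1; have := s p.2; rewrite set21 set22 => /(_ isT) + /(_ isT).
    by move=> -> ->.
  by rewrite !inE => /negbTE-> /negbTE->.
have ns' x : [exists y, (y, x) \in Q] && [exists y, (x, y) \in Q].
  by have /forall_inP := ns; apply; rewrite inE.
pose g := [ffun x => if x \in T then odflt x [pick y | (x, y) \in Q] else x].
have gQ x : x \in T -> (x, g x) \in Q.
  move=> xT; rewrite ffunE xT; case: pickP => //= no.
  by have /andP[_ /existsP[y]] := ns' x; have /= -> := no y.
have gV x : x \in vert H0 -> g x = x by move=> xV; rewrite ffunE inE xV.
(* The arcs (x, g x) are as many as the vertices of T, which is also the number
   of edges on T. *)
have aQ : arcs T g = Q1.
  apply/eqP; rewrite eqEcard; apply/andP; split.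
    apply/subsetP => _ /imsetP[x xT ->]; by rewrite in_set gQ.
  rewrite card_in_imset; last exact: arcs_inj_on.
  rewrite -(sum_ecount Q1 arc_edge) (eq_bigr (map_edges T h)) ?sum_ecount // => e _.
  by have [] := cQ e.
have E : map_edges T g =1 map_edges T h by move=> e; rewrite -ecount_arcs aQ; have [] := cQ e.
have gh : {in ~: T, g =1 h}.
  by move=> x; rewrite setCK => xV; rewrite gV // hV.
have [Pg Cg] := rigid_cycles E gh.
exists Q0, g; split=> //; last by rewrite aQ.
- rewrite inE; apply/andP; split; first by apply/und_eqP => e; have [] := cQ e.
  apply/forall_inP => x xV; have /andP[/existsP[y yx] /existsP[z xz]] := ns' x.
  apply/andP; split; apply/existsP; [exists y|exists z]; rewrite inE ?yx ?xz //=.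
  by have := ends_agree _ yx; rewrite /= => ->.
- split; first by move=> x y; apply: periodic_inj; rewrite Pg periodicT // inE.
  by apply/forallP => s; rewrite /cycle_type Cg -kT.
Qed.

(** An arc belongs to the orientation iff it starts in H0. *)
Lemma regular_form_inj (H0 : mgraph n) : negative H0 -> forall Q0 Q0' (g g' : {ffun 'I_n -> 'I_n}),
  Q0 \in orientations H0 -> Q0' \in orientations H0 ->
  (forall x, x \in vert H0 -> g x = x) -> (forall x, x \in vert H0 -> g' x = x) ->
  Q0 :|: arcs (~: vert H0) g = Q0' :|: arcs (~: vert H0) g' -> Q0 = Q0' /\ g = g'.
Proof.
move=> neg Q0 Q0' g g' oQ oQ' gV gV' /setP E.
have off Q x y : Q \in orientations H0 -> x \notin vert H0 -> ((x, y) \in Q) = false.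
  rewrite inE => /andP[uQ _]; apply: contraNF => xyQ.
  by have [] := orientation_arc neg uQ xyQ.
split.
  apply/setP => -[x y]; have [xV|xV] := boolP (x \in vert H0); last by rewrite !off.
  by have := E (x, y); rewrite !in_setU !mem_arcs !in_setC xV !orbF.
apply/ffunP => x; have [xV|xV] := boolP (x \in vert H0); first by rewrite gV // gV'.
by have := E (x, g x); rewrite !in_setU !mem_arcs !in_setC xV !off // eqxx => /esym/eqP.
Qed.

End Orientations.

(** * Forests are parent maps *)

Section Forests.
Context {n : nat}.
Implicit Types (Phi K : mgraph n) (c : seq 'I_n) (W : {set 'I_n}).

Lemma adj_sym K : symmetric (adj K).
Proof. by move=> x y; rewrite /adj setUC. Qed.

Lemma cycle_graph_edges c e : uniq c ->
  mult (cycle_graph c) e = map_edges [set x in c] (next c) e.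
Proof.
move=> u; have := @cycle_graphs_edges n [:: c] (next c) e; rewrite big_seq1 /= cats0.
by apply=> // c'; rewrite inE => /eqP->.
Qed.

Lemma acyclic_cycle Phi c : acyclic Phi -> vert Phi = setT -> is_cycle c ->
  (forall e, mult (cycle_graph c) e <= mult Phi e) -> False.
Proof.
move=> ac vP cc le; have /andP[uc _] := cc; apply: (ac c cc); split=> //.
  move=> e; rewrite cycle_graph_edges // => /ecount_gt0[x]; rewrite inE => xc <-.
  split; last by rewrite cards2; case: (_ != _).
  by apply/subsetP => y; rewrite !inE => /orP[]/eqP->; rewrite ?mem_next.
by rewrite vP; apply: subsetT.
Qed.

Lemma acyclic_loopless Phi x : acyclic Phi -> vert Phi = setT -> mult Phi [set x] = 0.
Proof.
move=> ac vP; apply/eqP; rewrite -leqn0 leqNgt; apply/negP => lx.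
apply: (@acyclic_cycle Phi [:: x]) => // e; rewrite cycle_graph_edges //.
have [->//|] := posnP (map_edges [set y in [:: x]] (next [:: x]) e).
case/ecount_gt0 => y; rewrite !inE => /eqP-> /=; rewrite eqxx setUid => <-.
apply: leq_trans lx; rewrite -(cards1 x); apply: subset_leq_card.
by apply/subsetP => z; rewrite !inE => /andP[].
Qed.

Lemma acyclic_simple Phi x y : acyclic Phi -> vert Phi = setT -> mult Phi [set x; y] <= 1.
Proof.
move=> ac vP; have [->|xy] := eqVneq x y; first by rewrite setUid acyclic_loopless.
have cc : is_cycle [:: x; y] by rewrite /is_cycle /= inE xy.
rewrite leqNgt; apply/negP => l2; apply: (@acyclic_cycle Phi [:: x; y]) => // e.
have [->//|] := posnP (mult (cycle_graph [:: x; y]) e).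
rewrite {1}cycle_graph_edges //; last by case/andP: cc.
move=> ge; apply: leq_trans (mult_cycle_graph_le2 _ cc) _; suff <- : [set x; y] = e by [].
case/ecount_gt0: ge => z; rewrite !inE => /orP[]/eqP-> /= <-; rewrite ?eqxx //.
by rewrite [y == x]eq_sym (negbTE xy) ?eqxx setUC.
Qed.

(** A cyclic walk without repeated vertices and with at least three of them
  uses every edge once, so its cycle graph is dominated by Phi. *)
Lemma acyclic_long Phi c : acyclic Phi -> vert Phi = setT -> uniq c -> 2 < size c ->
  cycle (adj Phi) c -> False.
Proof.
move=> ac vP uc c3 cyc; apply: (@acyclic_cycle Phi c) => // [|e].
  by rewrite /is_cycle uc; apply: ltnW (ltnW c3).
have [->//|] := posnP (mult (cycle_graph c) e); rewrite !cycle_graph_edges //.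
case/ecount_gt0 => x; rewrite inE => xc <-.
apply: leq_trans (next_cycle cyc xc); rewrite -(cards1 x); apply: subset_leq_card.
apply/subsetP => y; rewrite !inE => /andP[yc /eqP e'].
have : y \in [set x; next c x] by rewrite -e' set21.
rewrite !inE => /orP[//|/eqP ynx]; exfalso.
have : next c y = x by apply: (@set2_inj _ y); rewrite e' ynx setUC.
have fol : follows (next c) [:: c] by move=> c'; rewrite inE => /eqP->.
have uf : uniq (flatten [:: c]) by rewrite /= cats0.
have [sz xP] := follows_orbset uf fol (mem_head _ _) xc.
by move: c3; rewrite -sz orbset_gt2 // -ynx => /andP[_ /eqP].
Qed.

(** A path from a to b that avoids the edge {a, b} is closed by this edge to
  a cycle. *)
Lemma acyclic_bridge Phi a b : acyclic Phi -> vert Phi = setT -> adj Phi a b ->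
  ~~ connect (fun u v => adj Phi u v && ([set u; v] != [set a; b])) a b.
Proof.
move=> ac vP ab; apply/negP => /connectP[p /shortenP[{}p pp up _] eb].
have aP : path (adj Phi) a p by apply: sub_path pp => u v /andP[].
apply: (acyclic_long ac vP up).
  case: p pp eb {up aP} => [_ /= eb|z [|? ?] //=].
    by move: ab; rewrite eb /adj setUid acyclic_loopless.
  by rewrite andbT => /andP[_ nab] eb; rewrite eb eqxx in nab.
by rewrite /= rcons_path aP -eb adj_sym.
Qed.

(** The map p sends a vertex to its neighbour on a shortest path to W, whose
  length is d.  An edge {a, b} that joins no vertex to its parent would be
  avoided by the paths of parents that lead from a and from b to their common
  root, which contradicts [acyclic_bridge]. *)
Lemma forest_parent Phi W : is_mgraph Phi -> acyclic Phi -> vert Phi = setT ->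
  (forall x, exists! y, y \in W /\ connect (adj Phi) x y) ->
  exists (p : 'I_n -> 'I_n) (d : 'I_n -> nat),
    [/\ forall x, (d x == 0) = (x \in W), forall x, x \notin W -> d (p x) < d x
      & forall e, mult Phi e = map_edges (~: W) p e].
Proof.
move=> mg ac vP rt.
pose reach := fix reach k x := if k is k'.+1 then [exists y, adj Phi x y && reach k' y] else x \in W.
have ex x : exists k, reach k x.
  have [y [[yW /connectP[q + ey]] _]] := rt x.
  elim: q x ey => [|z q IH] x /= ey; first by exists 0; rewrite /= -ey.
  case/andP => xz /(IH _ ey)[k zk]; exists k.+1 => /=.
  by apply/existsP; exists z; rewrite xz.
pose d x := ex_minn (ex x).
have dr x : reach (d x) x by rewrite /d; case: ex_minnP.
have dle x k : reach k x -> d x <= k by rewrite /d; case: ex_minnP => m _; apply.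
have d0 x : (d x == 0) = (x \in W).
  apply/eqP/idP => [e|xW]; first by have := dr x; rewrite e.
  by apply/eqP; rewrite -leqn0; apply: dle.
pose p x := odflt x [pick y | adj Phi x y && (d y < d x)].
have pP x : x \notin W -> adj Phi x (p x) /\ d (p x) < d x.
  rewrite -d0 /p; case: pickP => [y /andP[]//|no]; have := dr x.
  case e : (d x) => [|k] //= /existsP[y /andP[xy /dle yk]] _.
  by have := no y; rewrite /= xy e ltnS yk.
have p_inj x y : x \notin W -> y \notin W -> [set x; p x] = [set y; p y] -> x = y.
  move=> /pP[_ dx] /pP[_ dy] e; have : x \in [set y; p y] by rewrite -e set21.
  rewrite !inE => /orP[/eqP //|/eqP xy].
  have : y \in [set x; p x] by rewrite e set21.
  rewrite !inE => /orP[/eqP ->//|/eqP yx]; rewrite -yx in dx; rewrite -xy in dy.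
  by have := ltn_trans dx dy; rewrite ltnn.
exists p, d; split=> // [x /pP[]//|e].
have [ge|] := posnP (mult Phi e).
  apply/eqP; rewrite ge eq_sym -leqn0 leqNgt; apply/negP => /ecount_gt0[x].
  by rewrite inE => /pP[xa _] xe; move: xa; rewrite /adj xe ge.
move=> ge; have [_ e2] := mg _ ge.
have [a [b eab]] : exists a b, e = [set a; b].
  case/andP: e2 => e1; rewrite leq_eqVlt => /orP[/cards2P[a [b [_ ->]]]|e'].
    by exists a, b.
  have /eqP/cards1P[a ->] : #|e| = 1 by apply/eqP; rewrite eqn_leq e1 -ltnS e'.
  by exists a, a; rewrite setUid.
subst e; have -> : mult Phi [set a; b] = 1 by apply/eqP; rewrite eqn_leq ge acyclic_simple.
apply/esym/eqP; rewrite eqn_leq; apply/andP; split.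
  apply/card_le1_eqP => x y; rewrite !inE => /andP[xW /eqP ex'] /andP[yW /eqP ey].
  by apply: p_inj => //; rewrite ex' ey.
rewrite lt0n; apply/negP => /eqP m0.
(* The forest without the edge {a, b}, assumed not to be a parent edge. *)
pose e' u v := adj Phi u v && ([set u; v] != [set a; b]).
have e's : symmetric e' by move=> u v; rewrite /e' adj_sym [in X in _ && (X != _)]setUC.
have rt' x : exists2 y, y \in W & connect e' x y.
  have [m] := ubnP (d x); elim: m x => // m IH x; rewrite ltnS => dm.
  have [xW|xW] := boolP (x \in W); first by exists x.
  have [xp dp] := pP x xW; have [y yW py] := IH _ (leq_trans dp dm).
  exists y => //; apply: connect_trans py; apply: connect1; rewrite /e' xp /=.
  apply/eqP => exy; have : 0 < map_edges (~: W) p [set a; b].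
    by rewrite -exy; apply: (ecount_ge1 (fun x => [set x; p x])); rewrite inE.
  by rewrite m0.
have sub x y : connect e' x y -> connect (adj Phi) x y.
  by apply: connect_sub => u v /andP[uv _]; apply: connect1.
(* Both ends of the edge {a, b} reach their root without using this edge, and
   the roots agree since a and b are adjacent. *)
have [y yW ay] := rt' a; have [y' yW' by'] := rt' b.
have [r [_ ur]] := rt a.
have eyr : r = y by apply: ur; split=> //; apply: sub.
have eyr' : r = y'.
  apply: ur; split=> //; apply: connect_trans (sub _ _ by'); exact: connect1.
apply/negP: (acyclic_bridge ac vP ge); rewrite negbK.
apply: connect_trans ay _; rewrite -eyr eyr' (sym_connect_sym e's) //.
Qed.

End Forests.

(** * Multigraphs whose components all contain a cycle, as maps *)

Lemma degree_ecount (T I : finType) (S : {set I}) (E : I -> {set T}) x :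
  \sum_(e : {set T} | x \in e) ecount S E e = #|[set i in S | x \in E i]|.
Proof.
under eq_bigr do rewrite ecountE.
rewrite exchange_big /= -sum1_card.
under [RHS]eq_bigl do rewrite inE.
rewrite [RHS]big_mkcondr /=; apply: eq_bigr => i _; case: ifP => xE.
  by rewrite (bigD1 (E i)) //= eqxx big1 // => e /andP[_]; rewrite eq_sym => /negbTE ->.
by rewrite big1 // => e xe; case: eqP => // Ee; rewrite -Ee xE in xe.
Qed.

Section CoreOfMap.
Context {n : nat}.
Implicit Types (F K C : mgraph n) (g h : 'I_n -> 'I_n) (S : {set 'I_n}).

(** A point x of a nontrivial cycle lies on the edge to its image and on the
  edge from its predecessor, which are attached to different points. *)
Lemma degree_moved h S x : {homo h : y / y \in S} -> S \subset moved h -> x \in S ->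
  2 <= \sum_(e : {set 'I_n} | x \in e) map_edges S h e.
Proof.
move=> hS SM xS; rewrite degree_ecount.
have SP := subset_trans SM (moved_periodic h).
have PS := @periodic_step _ h; have PI := @periodic_inj _ h.
have hf := f_finv_in PS PI (subsetP SP _ xS).
have xf : x != finv h x.
  have := subsetP SM _ xS; rewrite inE => /andP[_]; apply: contra => /eqP e.
  by rewrite {1}e hf.
apply: (@leq_trans #|[set x; finv h x]|); first by rewrite cards2 xf.
apply: subset_leq_card; apply/subsetP => y; rewrite !inE => /orP[]/eqP->.
  by rewrite xS eqxx.
by rewrite hf eqxx orbT (finv_in hS xS).
Qed.

Lemma is_mgraph_add_edges (V : {set 'I_n}) S g (m : {set 'I_n} -> nat) (H0 : mgraph n) :
  is_mgraph H0 -> vert H0 \subset V -> S \subset V -> {homo g : x / x \in V} ->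
  (forall e, m e = mult H0 e + map_edges S g e) ->
  is_mgraph (V, [ffun e => m e]).
Proof.
move=> mg HV SV gV mE e; rewrite /mult /= ffunE mE addn_gt0 => /orP[/mg[eV ec]|].
  by split=> //; apply: subset_trans HV.
case/ecount_gt0 => x xS <-; have xV := subsetP SV _ xS.
split; last by rewrite cards2; case: (_ != _).
by apply/subsetP => y; rewrite in_set2 => /orP[]/eqP->//; apply: gV.
Qed.

(** The graph called F(g) in the overview above. *)
Definition graph_of_map (H0 : mgraph n) g : mgraph n :=
  (setT, [ffun e => mult H0 e + map_edges (~: vert H0) g e]).

Definition core_of_map (H0 : mgraph n) g : mgraph n :=
  (periodic g, [ffun e => mult H0 e + map_edges (moved g) g e]).

Definition forest_of_map g : mgraph n :=
  (setT, [ffun e => map_edges (~: periodic g) g e]).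

Lemma mult_graph_of_map (H0 : mgraph n) g e :
  mult (graph_of_map H0 g) e = mult H0 e + map_edges (~: vert H0) g e.
Proof. by rewrite /mult /= ffunE. Qed.

Lemma mult_core_of_map (H0 : mgraph n) g e :
  mult (core_of_map H0 g) e = mult H0 e + map_edges (moved g) g e.
Proof. by rewrite /mult /= ffunE. Qed.

Lemma mult_forest_of_map g e :
  mult (forest_of_map g) e = map_edges (~: periodic g) g e.
Proof. by rewrite /mult /= ffunE. Qed.

Section FixedMap.
Context (H0 : mgraph n) (g : 'I_n -> 'I_n) (neg : negative H0).
Context (fix_g : forall x, (g x == x) = (x \in vert H0)).

Lemma moved_off : moved g = periodic g :\: vert H0.
Proof. by apply/setP => x; rewrite [LHS]in_set in_setD fix_g andbC. Qed.

Lemma vert_sub_periodic : vert H0 \subset periodic g.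
Proof. by apply/subsetP => x; rewrite -fix_g => /eqP; apply: fix_periodic. Qed.

(** The vertices of H0 are fixed points, hence periodic. *)
Lemma periodicE : periodic g = vert H0 :|: moved g.
Proof.
by rewrite moved_off -{1}(setID (periodic g) (vert H0)) (setIidPr vert_sub_periodic).
Qed.

Lemma map_edges_split e :
  map_edges (~: vert H0) g e = map_edges (moved g) g e + map_edges (~: periodic g) g e.
Proof.
rewrite /map_edges -ecountU; last first.
  by rewrite disjoints_subset setCK moved_periodic.
congr (ecount _ _ e); apply/setP => x; rewrite moved_off !inE.
case: (boolP (x \in vert H0)) => //= xV; last by rewrite orbN.
by have := subsetP vert_sub_periodic _ xV; rewrite inE => ->.
Qed.

Lemma core_sub_graph : subgraph (core_of_map H0 g) (graph_of_map H0 g).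
Proof.
split; last by move=> e; rewrite mult_core_of_map mult_graph_of_map map_edges_split addnA leq_addr.
  apply: (is_mgraph_add_edges (S := moved g) (g := g) (H0 := H0)) => //.
  - by case: neg.
  - exact: vert_sub_periodic.
  - exact: moved_periodic.
  exact: periodic_step.
exact: subsetT.
Qed.

Lemma min_degree2_core : min_degree2 (core_of_map H0 g).
Proof.
move=> x xC; have : x \in periodic g by [].
under eq_bigr do rewrite mult_core_of_map.
rewrite periodicE in_setU big_split /= => /orP[xV|xM].
  by case: neg => _ _ _ [_ md _] _; apply: leq_trans (md x xV) _; apply: leq_addr.
apply: leq_trans (leq_addl _ _); apply: degree_moved => //; exact: moved_step.
Qed.

(** Otherwise g maps S onto a set that contains S, so it permutes S, and the
  points of S are periodic. *)
Lemma exists_leaf S : S != set0 -> [disjoint S & periodic g] ->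
  exists2 x, x \in S & forall y, y \in S -> g y != x.
Proof.
move=> S0 dS; suff : ~~ (S \subset g @: S).
  case/subsetPn => x xS xg; exists x => // y yS; apply: contra xg => /eqP <-.
  exact: imset_f.
apply/negP => SgS; have eS : S = g @: S.
  by apply/eqP; rewrite eqEcard SgS leq_imset_card.
have SP : S \subset periodic g.
  apply: stable_periodic => [x xS|]; first by rewrite eS imset_f.
  by apply/imset_injP; rewrite -eS.
case/set0Pn: S0 => x xS; have := disjointFr dS xS; by rewrite (subsetP SP).
Qed.

(** Let x be a vertex of K without a preimage among the nonperiodic vertices
  of K.  Its preimages are not periodic either, so the only edge of K at x is
  {x, g x} and x has degree at most 1.  Hence all vertices of K are periodic. *)
Lemma core_max K : subgraph K (graph_of_map H0 g) -> min_degree2 K ->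
  subgraph K (core_of_map H0 g).
Proof.
case=> mK _ leK md; have [mg _ _ _ _] := neg.
have VP : vert K \subset periodic g.
  pose S := vert K :\: periodic g.
  have [/eqP|S0] := eqVneq S set0; first by rewrite setD_eq0.
  have dS : [disjoint S & periodic g] by rewrite disjoints_subset /S setDE subsetIr.
  have [x xS no] := exists_leaf S0 dS.
  have [xP xK] : x \notin periodic g /\ x \in vert K by move: xS; rewrite in_setD => /andP[].
  have := md x xK; rewrite leqNgt => /negP[]; rewrite ltnS.
  apply: (@leq_trans (\sum_(e : {set 'I_n} | x \in e)
    ecount [set x] (fun i => [set i; g i]) e)); last first.
    rewrite degree_ecount -(cards1 x); apply: subset_leq_card.
    by apply/subsetP => i; rewrite inE => /andP[].
  apply: leq_sum => e xe; have [->//|Ke] := posnP (mult K e).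
  have [eK _] := mK _ Ke; apply: leq_trans (leK e) _; rewrite mult_graph_of_map.
  have -> : mult H0 e = 0.
    apply/eqP; rewrite -leqn0 leqNgt; apply: contra xP => /mg[eV _].
    by apply: (subsetP vert_sub_periodic); apply: (subsetP eV).
  apply: subset_leq_card; apply/subsetP => i; rewrite [in X in X -> _]inE => /andP[iT /eqP ei].
  rewrite inE ei eqxx andbT in_set1.
  move: (xe); rewrite -ei in_set2 => /orP[/eqP->//|/eqP xgi].
  have iS : i \in S.
    rewrite in_setD (subsetP eK) ?andbT -?ei ?set21 //.
    by apply: contra xP => /periodic_step; rewrite -xgi.
  by have := no i iS; rewrite xgi eqxx.
split=> // e; have [->//|Ke] := posnP (mult K e).
have [eK _] := mK _ Ke; apply: leq_trans (leK e) _.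
rewrite mult_graph_of_map mult_core_of_map leq_add2l.
apply: subset_leq_card; apply/subsetP => i; rewrite [in X in X -> _]inE => /andP[iT /eqP ei].
rewrite inE ei eqxx andbT moved_off in_setD; apply/andP; split; first by rewrite inE in iT.
by apply: (subsetP VP); apply: (subsetP eK); rewrite -ei set21.
Qed.

(** The restriction of g to its cycles is injective and has the edges of g on
  them. *)
Lemma core_of_map_form : has_form H0 0 (fun s => cycle_type g s) (core_of_map H0 g).
Proof.
apply/has_formP; exists (perm_on_cycles g (cycles g)), (moved g).
have cov : cover (cycles g) = moved g := cover_partition (cycles_partition g).
split.
- split; first exact: perm_on_cycles_inj.
  by move=> x; rewrite /perm_on_cycles cov => /negbTE->.
- split; last exact: periodicE.
  by rewrite disjoint_sym disjoints_subset moved_off setDE subsetIr.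
- move=> e; rewrite mult_core_of_map; congr (_ + _); apply: eq_ecount => x xM.
  by rewrite /perm_on_cycles cov xM.
- apply/eqP; rewrite cards_eq0; apply/eqP/setP => x; rewrite in_set0 [LHS]in_set.
  by apply/andP => -[xM]; rewrite /perm_on_cycles cov xM; apply/negP; move: xM; rewrite inE => /andP[].
by move=> s; rewrite /cycle_type cycles_perm_on_cycles.
Qed.

Lemma forest_sub_graph e : mult (forest_of_map g) e <= mult (graph_of_map H0 g) e.
Proof. by rewrite mult_forest_of_map mult_graph_of_map map_edges_split addnA leq_addl. Qed.

Lemma forest_is_mgraph : is_mgraph (forest_of_map g).
Proof.
move=> e; rewrite mult_forest_of_map => /ecount_gt0[x _ <-].
by split; [apply: subsetT|rewrite cards2; case: (_ != _)].
Qed.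

(** A cycle in the forest would be a subgraph of minimal degree 2 of the whole
  graph, so it would lie in the core, whose vertices are periodic; but every edge
  of the forest starts at a point that is not periodic. *)
Lemma forest_acyclic : acyclic (forest_of_map g).
Proof.
move=> c cc [mc _ lec]; have /andP[uc c0] := cc.
have pE e : 0 < mult (cycle_graph c) e -> exists2 x, x \notin periodic g & [set x; g x] = e.
  move=> ce; have := leq_trans ce (lec e); rewrite mult_forest_of_map => /ecount_gt0[x].
  by rewrite inE; exists x.
have ce x : x \in c -> 0 < mult (cycle_graph c) [set x; next c x].
  move=> xc; rewrite cycle_graph_edges //; apply: (ecount_ge1 (fun x => [set x; next c x])).
  by rewrite inE.
have inj : injective (next c) := can_inj (prev_next uc).
have nS : {homo next c : x / x \in [set x in c]} by move=> x; rewrite !inE mem_next.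
have cM : [set x in c] \subset moved (next c).
  apply/subsetP => x; rewrite inE => xc; rewrite in_set periodicT // in_setT /=.
  apply/eqP => nx; have := ce x xc; rewrite nx setUid => /pE[y yP /setP e].
  have := e y; have := e (g y); rewrite !inE !eqxx orbT => /esym/eqP gy /esym/eqP yx.
  by move: yP; rewrite fix_periodic // gy yx.
have cP : [set x in c] \subset periodic g.
  have [] // : subgraph (cycle_graph c) (core_of_map H0 g).
  apply: core_max; first split=> //; first exact: subsetT.
    by move=> e; apply: leq_trans (lec e) (forest_sub_graph e).
  move=> x xc; under eq_bigr do rewrite cycle_graph_edges //.
  exact: degree_moved.
case: c c0 {cc mc lec uc inj nS cM} ce pE cP => // x c _ ce pE cP.
have [y yP e] := pE _ (ce x (mem_head _ _)).
move: yP; rewrite (subsetP cP) //; have : y \in [set x; next (x :: c) x] by rewrite -e set21.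
by rewrite !inE => /orP[]/eqP->; rewrite -?in_cons ?mem_next ?mem_head.
Qed.

(** Following g leads to a periodic point.  It is unique: for a periodic y, an
  edge of the forest joins points that both reach or both miss y under the map
  g', which is g stopped at the periodic points. *)
Lemma forest_root x : exists! y, y \in periodic g /\ connect (adj (forest_of_map g)) x y.
Proof.
have step z : z \notin periodic g -> adj (forest_of_map g) z (g z).
  move=> zP; rewrite /adj mult_forest_of_map; apply: (ecount_ge1 (fun x => [set x; g x])).
  by rewrite inE.
pose g' z := if z \in periodic g then z else g z.
have inv y a b : y \in periodic g -> adj (forest_of_map g) a b -> fconnect g' a y = fconnect g' b y.
  move=> yP; have gy : g' y = y by rewrite /g' yP.
  have E z : fconnect g' z y = fconnect g' (g' z) y.
    rewrite fconnect_eqVf; case: eqP => // ->; by rewrite gy connect0.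
  rewrite /adj mult_forest_of_map => /ecount_gt0[z]; rewrite in_setC => zP /setP e.
  have gz : g' z = g z by rewrite /g' (negbTE zP).
  have H w : w \in [set a; b] -> fconnect g' w y = fconnect g' z y.
    by rewrite -e !inE => /orP[]/eqP-> //; rewrite -gz -E.
  by rewrite !H ?set21 ?set22.
have [y [yP xy]] : exists y, y \in periodic g /\ connect (adj (forest_of_map g)) x y.
  have [k] := eventually_periodic g x; elim: k x => [|k IH] x /= kP; first by exists x.
  have [xP|xP] := boolP (x \in periodic g); first by exists x.
  rewrite -iterS iterSr in kP; have [y [yP gxy]] := IH _ kP.
  by exists y; split=> //; apply: connect_trans gxy; apply: connect1; apply: step.
exists y; split=> // z [zP xz].
have cl w : w \in periodic g -> connect (adj (forest_of_map g)) x w -> fconnect g' x w.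
  move=> wP xw; have := @closed_connect _ (adj (forest_of_map g)) [pred v | fconnect g' v w] _ _ _ xw.
  by rewrite !inE => -> // a b /(inv w _ _ wP).
have fixk w k : w \in periodic g -> iter k g' w = w by move=> wP; elim: k => //= k ->; rewrite /g' wP.
have /fconnect_iterP[i ei] := cl y yP xy; have /fconnect_iterP[j ej] := cl z zP xz.
by rewrite -(fixk y j yP) -(fixk z i zP) {1}ei ej -!iterD addnC.
Qed.

Lemma graph_of_map_Uset G : support_in (graph_of_map H0 g) G ->
  Uset G H0 (fun s => cycle_type g s) (graph_of_map H0 g).
Proof.
move=> sG; have [mg ll _ _ _] := neg; split=> //.
- apply: (is_mgraph_add_edges (S := ~: vert H0) (g := g) (H0 := H0)); rewrite ?subsetT //.
  by move=> x _; rewrite inE.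
- move=> x; rewrite mult_graph_of_map ll add0n; apply/eqP; rewrite -leqn0 leqNgt.
  apply/negP => /ecount_gt0[y]; rewrite in_setC => yV /setP e.
  have := e y; have := e (g y); rewrite !inE !eqxx orbT => /esym/eqP gy /esym/eqP yx.
  by move: yV; rewrite -fix_g gy yx eqxx.
exists (core_of_map H0 g); split.
- by split; [exact: core_sub_graph|exact: min_degree2_core|exact: core_max].
- exact: core_of_map_form.
exists (forest_of_map g); split=> //.
- exact: forest_is_mgraph.
- exact: forest_acyclic.
- by move=> e; rewrite mult_graph_of_map mult_core_of_map mult_forest_of_map map_edges_split addnA.
by move=> x _; apply: forest_root.
Qed.

End FixedMap.

(** On the core, g is the identity on H0 and runs along the cycles; elsewhere
  it is the parent map of the forest.  The depth d decreases along g off the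
  core, so that no new cycles arise. *)
Lemma Uset_graph_of_map G (H0 : mgraph n) l F : negative H0 -> Uset G H0 l F ->
  exists g : 'I_n -> 'I_n, [/\ forall x, (g x == x) = (x \in vert H0),
    graph_of_map H0 g = F & forall s : 'I_(n.-1), cycle_type g s = l s].
Proof.
move=> neg [mF vF lF sF [C [cC /has_formP[h [S [[ih id_h] [dj vC] mC h1 hl]]] [Phi [mP aP vP mFE rt]]]]].
rewrite vF in vP.
have rt' x : exists! y, y \in vert C /\ connect (adj Phi) x y by apply: rt; rewrite vF inE.
have [p [d [d0 dp mPE]]] := forest_parent mP aP vP rt'.
pose g x := if x \in vert C then h x else p x.
have hS x : x \in S -> h x \in S.
  by move=> xS; apply: contraLR (xS) => hxS; have /ih <- := id_h _ hxS.
have hV x : x \in vert H0 -> h x = x by move=> xV; apply: id_h; rewrite (disjointFr dj).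
have hm x : x \in S -> h x != x.
  move=> xS; apply/negP => hx; have : x \in [set x in S | h x == x] by rewrite inE xS.
  by move/eqP: h1; rewrite cards_eq0 => /eqP->; rewrite inE.
have gC : {homo g : x / x \in vert C}.
  move=> x xC; rewrite /g xC; move: xC; rewrite vC !in_setU => /orP[xV|xS].
    by rewrite hV // xV.
  by rewrite hS ?orbT.
have gE x : x \in vert C -> h x = g x by rewrite /g => ->.
have fixg x : (g x == x) = (x \in vert H0).
  rewrite /g; case: ifPn => xC.
    move: xC; rewrite vC in_setU; have [xV _|xV /= xS] := boolP (x \in vert H0).
      by rewrite hV ?eqxx.
    by apply/negbTE/hm.
  have -> : x \in vert H0 = false by apply: contraNF xC => xV; rewrite vC in_setU xV.
  by apply: contraNF xC => /eqP e; have := dp x; rewrite e ltnn; case: (_ \in _) => // /(_ isT).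
have Pg : periodic g = vert C.
  apply/eqP; rewrite eqEsubset; apply/andP; split; last first.
    by apply: stable_periodic => // x y xC yC; rewrite -!gE // => /ih.
  apply/subsetP => x; apply: contraTT => xC; rewrite inE; apply/negP => /fconnect_iterP[k e].
  suff : d x < d x by rewrite ltnn.
  have dx : 0 < d x by rewrite lt0n d0.
  rewrite {1}e; elim: k {e} => [|k IH] /=; first by rewrite /g (negbTE xC) dp.
  have [zC|zC] := boolP (iter k g (g x) \in vert C).
    by have /eqP -> : d (g (iter k g (g x))) == 0 by rewrite d0 gC.
  by rewrite {1}/g (negbTE zC); apply: ltn_trans (dp _ zC) IH.
have mS : moved g = S.
  rewrite (moved_off fixg) Pg vC setDUl setDv set0U; apply/setDidPl.
  by rewrite disjoint_sym.
exists g; split=> //.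
  rewrite [RHS]surjective_pairing; congr pair; first by rewrite -[RHS]/(vert F) vF.
  apply/ffunP => e; rewrite ffunE -[RHS]/(mult F e) mFE mC mPE (map_edges_split fixg) addnA.
  rewrite mS Pg; congr (_ + _ + _); apply: eq_ecount => x.
    by move=> xS; rewrite gE // vC in_setU xS orbT.
  by rewrite inE /g => /negbTE->.
move=> s; rewrite -hl /cycle_type.
have mh : moved h = S.
  apply/setP => x; rewrite in_set periodicT // in_setT /=.
  have [xS|xS] := boolP (x \in S); first exact: hm.
  by rewrite id_h // eqxx.
suff -> : cycles g = cycles h by [].
rewrite /cycles /orbits mS mh; apply: eq_in_imset => x xS.
have hC : {in vert C, g =1 h} by move=> y /gE.
by have [] := orbset_agree gC hC (_ : x \in vert C); rewrite // vC in_setU xS orbT.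
Qed.

End CoreOfMap.

(** * Weights *)

Local Open Scope ring_scope.

Lemma card_ord_bound n : (#|'I_n| <= n.-1.+1)%N.
Proof. by rewrite card_ord leqSpred. Qed.

Lemma set2_ltn n (a b i j : 'I_n) : (a < b)%N -> (i < j)%N ->
  ([set a; b] == [set i; j]) = (a == i) && (b == j).
Proof.
move=> ab ij; apply/eqP/andP => [e|[/eqP-> /eqP->] //].
have : a \in [set i; j] by rewrite -e set21.
have : b \in [set i; j] by rewrite -e set22.
rewrite !in_set2 => /orP[]/eqP eb /orP[]/eqP ea.
- by rewrite ea eb ltnn in ab.
- by rewrite ea eb ltnNge ltnW in ab.
- by rewrite ea eb !eqxx.
- by rewrite ea eb ltnn in ab.
Qed.

Section Weights.
Context {n : nat} {A : comPzRingType}.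
Context (w : 'I_n -> 'I_n -> A) (w_sym : forall i j, i != j -> w i j = w j i).

(** The weight of a multigraph in terms of its multiplicity function alone. *)
Definition edge_weight (m : {set 'I_n} -> nat) : A :=
  \prod_(i < n) \prod_(j < n | (i < j)%N) w i j ^+ m [set i; j].

Lemma weightE F : weight w F = edge_weight (mult F).
Proof. by []. Qed.

Lemma eq_edge_weight m m' : m =1 m' -> edge_weight m = edge_weight m'.
Proof. by move=> E; apply: eq_bigr => i _; apply: eq_bigr => j _; rewrite E. Qed.

Lemma edge_weightD m m' :
  edge_weight (fun e => m e + m' e)%N = edge_weight m * edge_weight m'.
Proof.
rewrite /edge_weight -big_split; apply: eq_bigr => i _ /=.
by rewrite -big_split; apply: eq_bigr => j _; rewrite exprD.
Qed.

Lemma edge_weight1 (a b : 'I_n) : a != b ->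
  edge_weight (fun e => [set a; b] == e) = w a b.
Proof.
wlog ab : a b / (a < b)%N => [H ne|_].
  have [ab|ab|ab] := ltngtP a b; first exact: H.
    by rewrite setUC (w_sym ne) H // eq_sym.
  by case/eqP: ne; apply: val_inj.
rewrite /edge_weight (bigD1 a) //= (bigD1 b) //= set2_ltn // !eqxx expr1.
rewrite big1 ?mulr1 => [|j /andP[aj jb]]; last first.
  by rewrite set2_ltn // eqxx eq_sym (negbTE jb) expr0.
rewrite big1 ?mulr1 // => i ia; rewrite big1 // => j ij.
by rewrite set2_ltn // eq_sym (negbTE ia) expr0.
Qed.

Lemma edge_weight_sum (I : finType) (S : {set I}) (f : I -> {set 'I_n} -> nat) :
  edge_weight (fun e => \sum_(k in S) f k e)%N = \prod_(k in S) edge_weight (f k).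
Proof.
rewrite /edge_weight exchange_big /=; apply: eq_bigr => i _.
rewrite exchange_big /=; apply: eq_bigr => j _.
by rewrite -prodrXr.
Qed.

(** The symmetry of w off the diagonal allows reading each edge in the
  direction in which it is given. *)
Lemma edge_weight_ecount (I : finType) (S : {set I}) (a b : I -> 'I_n) :
  (forall k, k \in S -> a k != b k) ->
  edge_weight (ecount S (fun k => [set a k; b k])) = \prod_(k in S) w (a k) (b k).
Proof.
move=> ab; rewrite (eq_edge_weight (ecountE S _)) edge_weight_sum.
by apply: eq_bigr => k /ab/edge_weight1.
Qed.

Lemma weight_graph_of_map (H0 : mgraph n) g :
  (forall x, (g x == x) = (x \in vert H0)) ->
  weight w (graph_of_map H0 g) = weight w H0 * \prod_(x in ~: vert H0) w x (g x).
Proof.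
move=> fx; rewrite weightE (eq_edge_weight (mult_graph_of_map H0 g)) edge_weightD.
by rewrite edge_weight_ecount // => x; rewrite inE -fx eq_sym.
Qed.

(** All orientations of H0 have the same weight, so only their number matters. *)
Lemma bracket_orientation (H0 : mgraph n) Q : negative H0 -> Q \in orientations H0 ->
  bracket (laplacian w) Q = (-1) ^+ nedges H0 * weight w H0.
Proof.
move=> neg; rewrite inE => /andP[uQ _].
have ar p : p \in Q -> p.1 != p.2.
  by case: p => a b /(orientation_arc neg uQ)[].
have E := und_eqP H0 Q uQ.
rewrite /nedges (eq_bigr (ecount Q arc_edge)) ?sum_ecount // -prodr_const weightE.
rewrite (eq_edge_weight E) edge_weight_ecount // -big_split /bracket /=.
by apply: eq_bigr => p /ar ne; rewrite mxE (negbTE ne) mulN1r.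
Qed.

(** A fixed point x of g outside H0 contributes the sum of w x m over m <> x.
  In the expanded product, f x is the chosen m at such a point, and g x at the
  points that g moves. *)
Lemma prod_laplacian (H0 : mgraph n) (g : {ffun 'I_n -> 'I_n}) : injective g ->
  (forall x, x \in vert H0 -> g x = x) ->
  \prod_(x in ~: vert H0) laplacian w x (g x) =
  (-1) ^+ #|moved g| *
    \sum_(f : {ffun 'I_n -> 'I_n} |
           [forall x, (f x == x) == (x \in vert H0)] && sub_perm g f)
      \prod_(x in ~: vert H0) w x (f x).
Proof.
move=> ig gV.
(* The values allowed for f x, and the factor that each of them contributes. *)
pose ok x y := if x \in vert H0 then y == x else if g x != x then y == g x else y != x.
pose val x y : A := if x \in vert H0 then 1 else if g x != x then - w x y else w x y.
transitivity (\prod_x \sum_(y | ok x y) val x y).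
  rewrite big_mkcond; apply: eq_bigr => x _; rewrite inE /ok /val.
  case: (boolP (x \in vert H0)) => /= xV; first by rewrite (big_pred1 x).
  have [gx|gx] /= := eqVneq (g x) x; first by rewrite gx mxE eqxx.
  by rewrite (big_pred1 (g x)) // mxE eq_sym (negbTE gx).
rewrite bigA_distr_big_dep big_distrr /=; apply: eq_big => f.
  apply/familyP/andP => [okf|[/forallP fx /andP[_ /forallP gf]] x].
    split; last first.
      apply/andP; split; first exact/injectiveP.
      apply/forallP => x; apply/implyP => gx; have := okf x; rewrite unfold_in /ok gx.
      by case: ifP => [/gV gxx|_ /eqP-> //]; rewrite gxx eqxx in gx.
    apply/forallP => x; have := okf x; rewrite unfold_in /ok; case: ifP => [_ ->//|xV].
    by case: ifP => [gx /eqP->|_ /negbTE-> //]; rewrite (negbTE gx).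
  rewrite unfold_in /ok; have := fx x; case: ifP => [_ /eqP -> //|xV /eqP fxx].
  by case: ifP => [gx|]; [rewrite eq_sym (implyP (gf x))|rewrite fxx].
move=> _; rewrite -prodr_const [in RHS]big_mkcond [X in _ = _ * X]big_mkcond /= -big_split.
apply: eq_bigr => x _; rewrite /val in_setC [_ \in moved g]in_set periodicT // in_setT /=.
case: (boolP (x \in vert H0)) => /= [/gV->|xV]; first by rewrite eqxx mulr1.
by case: ifP => _; rewrite ?mulN1r ?mul1r.
Qed.

End Weights.

(** * The two expansions over maps *)

Section Sums.
Context {n : nat} {A : comPzRingType}.
Context (w : 'I_n -> 'I_n -> A) (w_sym : forall i j, i != j -> w i j = w j i).
Context (H0 : mgraph n) (neg : negative H0).

(** The maps over which both sides are expanded. *)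
Definition fixes_exactly_H0 (f : {ffun 'I_n -> 'I_n}) := [forall x, (f x == x) == (x \in vert H0)].

Definition cycle_perms (k : 'I_(n.-1) -> nat) : {set {ffun 'I_n -> 'I_n}} :=
  [set g : {ffun 'I_n -> 'I_n} |
    [&& injectiveb g, [forall x in vert H0, g x == x] & has_cycle_type g k]].

Lemma cycle_permsP k (g : {ffun 'I_n -> 'I_n}) : reflect
  [/\ injective g, forall x, x \in vert H0 -> g x = x & has_cycle_type g k]
  (g \in cycle_perms k).
Proof.
rewrite inE; apply: (iffP and3P) => -[ig gV kg]; split=> //.
- exact/injectiveP.
- by move=> x xV; apply/eqP; apply: (forall_inP gV).
- exact/injectiveP.
by apply/forall_inP => x xV; apply/eqP/gV.
Qed.

Lemma rho_orientations_perms k :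
  rho w H0 k = \sum_(Q0 in orientations H0) \sum_(g in cycle_perms k)
    bracket (laplacian w) (Q0 :|: arcs (~: vert H0) g).
Proof.
rewrite pair_big /= /rho.
pose U p := p.1 :|: arcs (~: vert H0) (p.2 : {ffun 'I_n -> 'I_n}).
pose D := [pred p | (p.1 \in orientations H0) && (p.2 \in cycle_perms k)].
rewrite -(big_imset (h := U) (A := D)) /=; last first.
  move=> [Q0 g] [Q0' g'] /andP[/= oQ /cycle_permsP[_ gV _]] /andP[/= oQ' /cycle_permsP[_ gV' _]].
  by case/(regular_form_inj neg oQ oQ' gV gV') => -> ->.
apply: eq_bigl => Q; apply/asboolP/imsetP.
  case/(regular_formP _ _ neg) => Q0 [g [oQ [ig kg] gV ->]]; exists (Q0, g) => //.
  by rewrite inE /= oQ; apply/cycle_permsP.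
case=> -[Q0 g] /andP[/= oQ /cycle_permsP[ig gV kg]] ->.
by apply/(regular_formP _ _ neg); exists Q0, g.
Qed.

Lemma bracket_union k Q0 (g : {ffun 'I_n -> 'I_n}) :
  Q0 \in orientations H0 -> g \in cycle_perms k ->
  bracket (laplacian w) (Q0 :|: arcs (~: vert H0) g) =
  (-1) ^+ nedges_form H0 k * weight w H0 *
    \sum_(f : {ffun 'I_n -> 'I_n} | fixes_exactly_H0 f && sub_perm g f)
      \prod_(x in ~: vert H0) w x (f x).
Proof.
move=> oQ /cycle_permsP[ig gV kg].
have dj : [disjoint Q0 & arcs (~: vert H0) g].
  rewrite disjoints_subset; apply/subsetP => -[a b] abQ; rewrite inE mem_arcs inE.
  move: oQ; rewrite inE => /andP[uQ0 _].
  by have [-> _ _ _] := orientation_arc neg uQ0 abQ.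
have -> : bracket (laplacian w) (Q0 :|: arcs (~: vert H0) g) =
    bracket (laplacian w) Q0 * \prod_(x in ~: vert H0) laplacian w x (g x).
  rewrite -(big_imset (h := fun x => (x, g x)) (A := ~: vert H0)
    (fun p => laplacian w p.1 p.2)); last first.
    exact: arcs_inj_on.
  by rewrite /bracket -bigU //=; apply: eq_bigl => p; rewrite !inE.
rewrite (bracket_orientation w_sym neg oQ) (prod_laplacian w ig gV) /nedges_form exprD.
rewrite (card_moved g (card_ord_bound n)) (eq_bigr (fun s : 'I_(n.-1) => s.+2 * k s)%N); last first.
  by move=> s _; rewrite (eqP (forallP kg s)).
by rewrite -!mulrA; congr (_ * _); rewrite mulrCA.
Qed.

(** After the sums over g and f are exchanged, the g that occur with a given f
  are its sub-permutations of cycle type k. *)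
Lemma rho_maps k :
  rho w H0 k = (-1) ^+ nedges_form H0 k * (orient_count H0)%:R *
    \sum_(f : {ffun 'I_n -> 'I_n} | fixes_exactly_H0 f)
       (\prod_(s < n.-1) 'C(cycle_type f s, k s))%:R * weight w (graph_of_map H0 f).
Proof.
rewrite rho_orientations_perms.
rewrite (eq_bigr (fun=> \sum_(g in cycle_perms k) ((-1) ^+ nedges_form H0 k * weight w H0 *
    \sum_(f : {ffun 'I_n -> 'I_n} | fixes_exactly_H0 f && sub_perm g f)
      \prod_(x in ~: vert H0) w x (f x)))); last first.
  by move=> Q0 oQ /=; apply: eq_bigr => g gk; apply: bracket_union.
rewrite sumr_const -[LHS]mulr_natl -/(orient_count H0) -big_distrr /=.
rewrite (exchange_big_dep fixes_exactly_H0) /=; last by move=> g f _ /andP[].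
rewrite !big_distrr /=; apply: eq_bigr => f /forallP fx.
have fx' x : (f x == x) = (x \in vert H0) := eqP (fx x).
rewrite (weight_graph_of_map w_sym fx') sumr_const.
have -> : #|[pred g in cycle_perms k | fixes_exactly_H0 f && sub_perm g f]| =
    (\prod_(s < n.-1) 'C(cycle_type f s, k s))%N.
  rewrite -(card_sub_perm f k (card_ord_bound n)); apply: eq_card => g.
  rewrite [LHS]inE [RHS]inE; apply/andP/andP.
    by case=> /cycle_permsP[_ _ ->] /andP[_ ->].
  case=> sg kg; split; last by rewrite sg andbT; apply/forallP.
  have /andP[/injectiveP ig /forallP gf] := sg.
  apply/cycle_permsP; split=> // x; rewrite -fx' => /eqP fxx.
  by have := gf x; rewrite fxx; case: eqP.
rewrite -(mulr_natl (\prod_(x in ~: vert H0) w x (f x))) !mulrA; congr (_ * _).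
by rewrite [X in X * _ * _ = _]mulrC mulrAC.
Qed.

Lemma same_graph (f g : {ffun 'I_n -> 'I_n}) : fixes_exactly_H0 g ->
  (fixes_exactly_H0 f && (graph_of_map H0 f == graph_of_map H0 g)) = same_edges f g.
Proof.
move=> /forallP fg; have gx x : (g x == x) = (x \in vert H0) := eqP (fg x).
have -> : same_edges f g = [forall x, (f x == x) == (g x == x)] &&
    [forall e, map_edges (~: vert H0) f e == map_edges (~: vert H0) g e].
  have -> : ~: vert H0 = [set x | g x != x] by apply/setP => x; rewrite !inE gx.
  by [].
congr (_ && _); first by apply: eq_forallb => x; rewrite gx.
apply/eqP/forallP => [e0 e|E].
  by have := congr1 (fun K => mult K e) e0; rewrite !mult_graph_of_map => /addnI ->.
by congr pair; apply/ffunP => e; rewrite !ffunE (eqP (E e)).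
Qed.

Lemma same_graph_cycle_type (f g : {ffun 'I_n -> 'I_n}) s : fixes_exactly_H0 f -> fixes_exactly_H0 g ->
  graph_of_map H0 f = graph_of_map H0 g -> cycle_type f s = cycle_type g s.
Proof.
move=> /forallP ff /forallP fg e0.
have E : map_edges (~: vert H0) f =1 map_edges (~: vert H0) g.
  by move=> e; have := congr1 (fun K => mult K e) e0; rewrite !mult_graph_of_map => /addnI ->.
have fg' : {in ~: (~: vert H0), f =1 g}.
  move=> x; rewrite setCK => xV; have := ff x; have := fg x; rewrite xV.
  by move=> /eqP/eqP -> /eqP/eqP ->.
by have [_ C] := rigid_cycles E fg'; rewrite /cycle_type C.
Qed.

(** A graph of a map that leaves G uses an edge of weight 0. *)
Lemma weight_out (G : {set {set 'I_n}})
  (hw_out : forall i j, i != j -> [set i; j] \notin G -> w i j = 0)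
  (hH0G : support_in H0 G) (f : {ffun 'I_n -> 'I_n}) : fixes_exactly_H0 f ->
  ~ support_in (graph_of_map H0 f) G -> weight w (graph_of_map H0 f) = 0.
Proof.
move=> /forallP ff nS; have fx x : (f x == x) = (x \in vert H0) := eqP (ff x).
rewrite (weight_graph_of_map w_sym fx).
have [/forall_inP all_in|] := boolP [forall x in ~: vert H0, [set x; f x] \in G].
  case: nS => e; rewrite mult_graph_of_map addn_gt0 => /orP[/hH0G//|/ecount_gt0[x xT <-]].
  exact: all_in.
rewrite negb_forall_in => /exists_inP[x xT xG].
rewrite (bigD1 x) //= hw_out ?mul0r ?mulr0 //.
by move: xT; rewrite inE -fx eq_sym.
Qed.

Lemma Zsum_seq (U : set (mgraph n)) : finite_set U ->
  exists s : seq ({set 'I_n} * {ffun {set 'I_n} -> nat}),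
    [/\ uniq s, forall F, F \in s <-> U F & Zsum w U = \sum_(F <- s) weight w F].
Proof.
move=> fin; exists (finmap.enum_fset (fset_set U)); split.
- exact: finmap.fset_uniq.
- move=> F; have e := in_fset_set fin F; split=> [Fs|/mem_set FU].
    exact/set_mem/(etrans (esym e) Fs).
  exact: (etrans e FU).
by rewrite /Zsum fsbig_finite.
Qed.

(** Each graph in Uset is the graph of 2^(l_3 + .. + l_n) maps, all with cycle
  numbers l.  Conversely, the graph of a map with these cycle numbers is in Uset
  or has weight 0. *)
Lemma Zsum_maps (G : {set {set 'I_n}})
  (hw_out : forall i j, i != j -> [set i; j] \notin G -> w i j = 0)
  (hH0G : support_in H0 G) (l : 'I_(n.-1) -> nat) :
  2%:R ^+ (\sum_(s < n.-1 | (3 <= s.+2)%N) l s)%N * Zsum w (Uset G H0 l) =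
  \sum_(f : {ffun 'I_n -> 'I_n} | fixes_exactly_H0 f && has_cycle_type f l) weight w (graph_of_map H0 f).
Proof.
have [s [us sU ->]] := Zsum_seq (finite_Uset G H0 l).
rewrite big_distrr /=.
rewrite (eq_big_seq (fun F => \sum_(f : {ffun 'I_n -> 'I_n} | fixes_exactly_H0 f && (graph_of_map H0 f == F))
    weight w (graph_of_map H0 f))); last first.
  move=> F /sU FU; have [g0 [fg0 <- lg]] := Uset_graph_of_map neg FU.
  pose g := [ffun x => g0 x]; have gE : g0 = g by rewrite fun_of_finfunK.
  have fg : fixes_exactly_H0 g by apply/forallP => x; rewrite ffunE fg0.
  rewrite gE (eq_bigr (fun=> weight w (graph_of_map H0 g))); last by move=> f /andP[_ /eqP ->].
  rewrite sumr_const (eq_card (B := [set f : {ffun 'I_n -> 'I_n} | same_edges f g])); last first.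
    by move=> f; rewrite [RHS]inE -same_graph.
  rewrite (card_same_edges g (card_ord_bound n)) -[RHS]mulr_natl natrX; congr (_ ^+ _ * _).
  by apply: eq_bigr => i _; rewrite -lg gE.
rewrite (exchange_big_dep fixes_exactly_H0) /=; last by move=> F f _ /andP[].
rewrite [RHS]big_mkcondr; apply: eq_bigr => f ff.
have fx x : (f x == x) = (x \in vert H0) := eqP (forallP ff x).
rewrite (eq_bigl (fun F => F == graph_of_map H0 f)); last by move=> F; rewrite ff eq_sym.
have [fU|fU] := boolP (graph_of_map H0 f \in s).
  rewrite -big_filter.
  have -> : [seq F <- s | F == graph_of_map H0 f] = [:: graph_of_map H0 f].
    exact: filter_pred1_uniq.
  rewrite big_seq1; have [g0 [fg0 eg lg]] := Uset_graph_of_map neg (proj1 (sU _) fU).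
  have gE : g0 = [ffun x => g0 x] by rewrite fun_of_finfunK.
  have fg : fixes_exactly_H0 [ffun x => g0 x] by apply/forallP => x; rewrite ffunE fg0.
  rewrite ifT //; apply/forallP => i; rewrite -lg gE; apply/eqP.
  by apply: same_graph_cycle_type => //; rewrite -gE.
rewrite big_seq_cond big_pred0; last first.
  by move=> F; apply/andP => -[FU /eqP eF]; rewrite -eF FU in fU.
case: ifP => // /forallP lf; apply/esym/(weight_out hw_out hH0G ff) => sG.
move/negP: fU; apply; apply/sU.
have -> : l = fun i : 'I_(n.-1) => cycle_type f i by apply/funext => i; rewrite (eqP (lf i)).
exact: graph_of_map_Uset.
Qed.

End Sums.

Theorem theorem3 (n : nat) (A : comPzRingType) (G : {set {set 'I_n}})
    (w : 'I_n -> 'I_n -> A) (H0 : mgraph n) (k : 'I_(n.-1) -> nat)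
    (hG : simple_graph G)
    (hw_sym : forall i j : 'I_n, i != j -> w i j = w j i)
    (hw_out : forall i j : 'I_n, i != j -> [set i; j]%SET \notin G -> w i j = 0)
    (hH0 : negative H0) (hH0G : support_in H0 G) :
  rho w H0 k =
    (-1) ^+ nedges_form H0 k * (orient_count H0)%:R *
    \sum_(l : {ffun 'I_(n.-1) -> 'I_n.+1} | [forall s, (k s <= l s)%N])
      (\prod_(s < n.-1) 'C(l s, k s))%:R *
      2%:R ^+ (\sum_(s < n.-1 | (3 <= s.+2)%N) l s)%N *
      Zsum w (Uset G H0 (fun s => l s)).
Proof.
rewrite (rho_maps hw_sym hH0); congr (_ * _).
pose F l := (\prod_(s < n.-1) 'C(l s, k s))%:R *
  \sum_(f : {ffun 'I_n -> 'I_n} | fixes_exactly_H0 H0 f && has_cycle_type f l) weight w (graph_of_map H0 f).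
(* The condition k <= l can be dropped: otherwise a binomial coefficient
   vanishes. *)
transitivity (\sum_(l : {ffun 'I_(n.-1) -> 'I_n.+1}) F (fun s => l s)); last first.
  rewrite [RHS]big_mkcond; apply: eq_bigr => l _; rewrite -mulrA Zsum_maps //.
  case: ifPn => //; rewrite negb_forall => /existsP[s]; rewrite -ltnNge => ls.
  by rewrite /F (bigD1 s) //= bin_small // mul0n mul0r.
(* A map has at most n cycles of each length, so its cycle numbers are among
   the l of the sum. *)
have lt f (s : 'I_(n.-1)) : (cycle_type (f : 'I_n -> 'I_n) s < n.+1)%N.
  rewrite ltnS -[leqRHS](card_ord n); apply: leq_trans (max_card (mem (moved f))).
  rewrite (card_moved f (card_ord_bound n)) (bigD1 s) //=.
  by apply: leq_trans (leq_addr _ _); rewrite leq_pmull.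
rewrite /F; under [RHS]eq_bigr do rewrite big_distrr /=.
rewrite (exchange_big_dep (fixes_exactly_H0 H0)) /=; last by move=> l f _ /andP[].
apply: eq_bigr => f ff; rewrite (big_pred1 [ffun s => Ordinal (lt f s)]).
  by congr (_%:R * _); apply: eq_bigr => s _; rewrite ffunE.
move=> l; rewrite ff /=; apply/forallP/eqP => [fl|-> s]; last by rewrite ffunE.
by apply/ffunP => s; rewrite ffunE; apply: val_inj; rewrite /= (eqP (fl s)).
Qed.
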